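(* Let $\mathbb A$ be a three-dimensional non-degenerate evolution algebra over an algebraically closed field $\mathbb F$ of characteristic zero. Then $\mathbb A$ is isomorphic to only one of the following algebras (given by structure matrices in a natural basis $\{e_1,e_2,e_3\}$). (I) If $\delta(\mathbb A)=(1,1,1)$: - If $\Delta(\mathbb A)=(\mathbf O_1,\mathbf O_1,\mathbf O_1)$, then $\mathbb A$ is isomorphic to one of $\mathbf A_{3,1}^{\alpha,\beta,\gamma}:\begin{pmatrix}0&1&\alpha\\\beta&0&1\\1&\gamma&0\end{pmatrix}$, $\ \mathbf A_{3,2}^{\alpha}:\begin{pmatrix}0&0&0\\\alpha&0&1\\1&1&0\end{pmatrix}$. - If $\Delta(\mathbb A)=(\mathbf O_1,\mathbf O_1,\mathbf E_1)$, then $\mathbb A$ is isomorphic to one of $\mathbf A_{3,3}^{\Lambda}:\begin{pmatrix}0&\alpha&\beta\\\gamma&0&\epsilon\\1&1&1\end{pmatrix}$, $\ \mathbf A_{3,4}^{\alpha,\beta,\gamma}:\begin{pmatrix}0&\alpha&\beta\\1&0&\gamma\\0&1&1\end{pmatrix}$, $\ \mathbf A_{3,5}^{\alpha,\beta}:\begin{pmatrix}0&1&\alpha\\1&0&\beta\\0&0&1\end{pmatrix}$. - If $\Delta(\mathbb A)=(\mathbf O_1,\mathbf E_1,\mathbf E_1)$, then $\mathbb A$ is isomorphic to $\mathbf A_{3,6}^{\Lambda}:\begin{pmatrix}0&\alpha&\beta\\1&1&\gamma\\\epsilon&\zeta&1\end{pmatrix}$. - If $\Delta(\mathbb A)=(\mathbf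 E_1,\mathbf E_1,\mathbf E_1)$, then $\mathbb A$ is isomorphic to $\mathbf A_{3,7}^{\Lambda}:\begin{pmatrix}1&\alpha&\beta\\\gamma&1&\epsilon\\\zeta&\xi&1\end{pmatrix}$. In case (I) the only isomorphisms are between algebras in the same family, and they are permutations of the basis elements. (II) If $\delta(\mathbb A)=(2,1)$: - If $\Delta(\mathbb A)=(\mathbf O_2,\mathbf O_1)$, then $\mathbb A$ is isomorphic to one of $\mathbf B_{3,1}:\begin{pmatrix}0&0&0\\0&0&1\\1&1&0\end{pmatrix}$, $\ \mathbf B_{3,2}:\begin{pmatrix}0&0&1\\0&0&\mathbf i\\1&1&0\end{pmatrix}$. - If $\Delta(\mathbb A)=(\mathbf O_2,\mathbf E_1)$, then $\mathbb A$ is isomorphic to one of $\mathbf B_{3,3}^{\alpha}:\begin{pmatrix}0&0&0\\0&0&1\\\alpha&\alpha&1\end{pmatrix}$, $\ \mathbf B_{3,4}:\begin{pmatrix}0&0&1\\0&0&\mathbf i\\1&1&1\end{pmatrix}$. - If $\Delta(\mathbb A)=(\mathbf E_2,\mathbf O_1)$, then $\mathbb A$ is isomorphic to one of $\mathbf B_{3,5}^{\alpha,\beta}:\begin{pmatrix}1&1&\alpha\\0&0&\beta\\1&1&0\end{pmatrix}$, $\ \mathbf B_{3,6}^{\alpha}:\begin{pmatrix}1&1&\alpha\\0&0&1\\0&0&0\end{pmatrix}$; the isomorphisms here are $\mathbf B_{3,5}^{\alpha,\beta}\cong\mathbf B_{3,5}^{\alpha,-\beta}$ and $\mathbf B_{3,6}^{\alpha}\cong\mathbf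 B_{3,6}^{-\alpha}$. - If $\Delta(\mathbb A)=(\mathbf E_2,\mathbf E_1)$, then $\mathbb A$ is isomorphic to $\mathbf B_{3,7}^{\alpha,\beta,\gamma}:\begin{pmatrix}1&1&\beta\\0&0&\gamma\\\alpha&\alpha&1\end{pmatrix}$, and $\mathbf B_{3,7}^{\alpha,\beta,\gamma}\cong\mathbf B_{3,7}^{\alpha,\beta,-\gamma}$. - If $\Delta(\mathbb A)=(\mathbf I_2,\mathbf O_1)$, then $\mathbb A$ is isomorphic to one of $\mathbf B_{3,8}^{\alpha}:\begin{pmatrix}1&1&\alpha\\\mathbf i&\mathbf i&0\\1&1&0\end{pmatrix}$, $\ \mathbf B_{3,9}^{\pm}:\begin{pmatrix}1&1&1\\\mathbf i&\mathbf i&\pm\mathbf i\\1&1&0\end{pmatrix}$, $\ \mathbf B_{3,10}:\begin{pmatrix}1&1&1\\\mathbf i&\mathbf i&0\\0&0&0\end{pmatrix}$, $\ \mathbf B_{3,11}:\begin{pmatrix}1&1&1\\\mathbf i&\mathbf i&-\mathbf i\\0&0&0\end{pmatrix}$. - If $\Delta(\mathbb A)=(\mathbf I_2,\mathbf E_1)$, then $\mathbb A$ is isomorphic to one of $\mathbf B_{3,12}^{\alpha,\beta}:\begin{pmatrix}1&1&\alpha\\\mathbf i&\mathbf i&\beta\\1&1&1\end{pmatrix}$, $\ \mathbf B_{3,13}^{\alpha\neq0}:\begin{pmatrix}1&1&\alpha\\\mathbf i&\mathbf i&0\\0&0&1\end{pmatrix}$, $\ \mathbf B_{3,14}:\begin{pmatrix}1&1&1\\\mathbf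 i&\mathbf i&\mathbf i\\0&0&1\end{pmatrix}$, $\ \mathbf B_{3,15}^{\alpha}:\begin{pmatrix}1&1&\alpha\\\mathbf i&\mathbf i&-\alpha\mathbf i\\0&0&1\end{pmatrix}$. (III) If $\delta(\mathbb A)=(3)$, then $\mathbb A$ is isomorphic either to $\mathbf E_3$ or to $\mathbf I_3$. The parameters in each family $\mathbf A_{3,*}^{*}$ or $\mathbf B_{3,*}^{*}$ are taken freely in $\mathbb F$, but in such a way that the resulting algebra has the $\delta$-index corresponding to that family.
   Context: Algebras are finite-dimensional over $\mathbb F$ with a bilinear product, not necessarily associative. An evolution algebra is an algebra having a basis $\mathbf B=\{e_1,\dots,e_n\}$ (a natural basis) with $e_ie_j=0$ for $i\ne j$; its structure matrix relative to $\mathbf B$ is $(w_{ki})$ where $e_i^2=\sum_k w_{ki}e_k$ (column $i$ gives $e_i^2$). An evolution algebra is written by giving its structure matrix. The superscript $\Lambda$ stands for the tuple of all Greek parameters appearing in the matrix, and $\mathbf i\in\mathbb F$ is a fixed element with $\mathbf i^2=-1$. The algebra is non-degenerate if $\mathrm{Ann}(\mathbb A)=\{x: x\mathbb A+\mathbb Ax=0\}$ is zero. An extending evolution subspace is a linear subspace spanned by a subset of some natural basis of $\mathbb A$. For subspaces $X,Y$, $XY$ denotes the linear span of all products, and $X^2=XX$. Every non-degenerate evolution algebra has a unique (up to order) decomposition $\mathbb A=\mathbb E_1\oplus\dots\oplus\mathbb E_r$, where the $\mathbb E_i$ are extending evolution subspaces with $\dim(\mathbb E_i^2)=1$, and $\mathbb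 E_i\mathbb E_j=0$, $\dim(\mathbb E_i^2+\mathbb E_j^2)=2$ for $i\neq j$. The $\delta$-index is $\delta(\mathbb A)=(\dim\mathbb E_1,\dots,\dim\mathbb E_r)$, arranged in non-increasing order. Let $\mathbb A_i$ be the algebra on $\mathbb E_i$ with product $x\cdot y=\pi_{\mathbb E_i}(xy)$, where $\pi_{\mathbb E_i}$ is the projection of $\mathbb A$ onto $\mathbb E_i$ along the other summands. With $m=\dim\mathbb E_i$, it is isomorphic to exactly one of the following (basis $e_1,\dots,e_m$, $e_ie_j=0$ for $i\ne j$): $\mathbf O_m$ (zero product); $\mathbf E_m$: $e_1^2=\dots=e_m^2=e_1$; or, for $m\ge2$, $\mathbf I_m$: $e_1^2=\dots=e_m^2=e_1+\mathbf ie_2$. The $\Delta$-trace $\Delta(\mathbb A)$ is the sequence of these isomorphism types, ordered by non-increasing dimension and, in equal dimension, with $\mathbf O$ first, then $\mathbf E$, then $\mathbf I$.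
   Formalization: In case (I), isomorphisms are shown to be permutations of the basis elements up to nonzero scalars (literal permutations for A_{3,7} only), since the literal claim fails: e_1 → −e_1 gives A_{3,6}^{α,β,γ,ε,ζ} ≅ A_{3,6}^{−α,−β,γ,ε,ζ}. *)

(* Defs.v *)
Set Warnings "-notation-overridden,-ambiguous-paths,-redundant-canonical-projection".

From HB Require Import structures.
From mathcomp Require Import all_boot all_order all_fingroup all_algebra.

Set Implicit Arguments.
Unset Strict Implicit.
Unset Printing Implicit Defensive.

Import GRing.Theory.
Local Open Scope ring_scope.

Record naAlgebra (F : fieldType) := NaAlgebra {
  carrier :> vectType F;
  mul : {bilinear carrier -> carrier -> carrier} }.

Arguments mul {F A} : rename.

Definition is_algebra_iso (F : fieldType) (A B : naAlgebra F) (f : 'Hom(A, B)) :=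
  bijective f /\ (forall x y : A, f (mul x y) = mul (f x) (f y)).

Definition isomorphic (F : fieldType) (A B : naAlgebra F) : Prop :=
  exists f : 'Hom(A, B), is_algebra_iso f.

Section EvolutionMatrix.
Variables (F : fieldType) (n : nat) (W : 'M[F]_n).

(* Entrywise product of coordinates followed by W, so that the canonical basis
   vectors satisfy e_i e_j = 0 for i <> j and e_i e_i = column i of W. *)
Definition evo_mul (x y : 'cV[F]_n) : 'cV[F]_n :=
  W *m \col_k (x k 0 * y k 0).

Lemma evo_mul_bilinear : bilinear_for *:%R *:%R evo_mul.
Proof.
split=> z a x y; rewrite /evo_mul /= scalemxAr -mulmxDr; congr (_ *m _);
  by apply/colP=> k; rewrite !mxE ?mulrDl ?mulrDr ?mulrA // [_ * a]mulrC.
Qed.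

HB.instance Definition _ := bilinear_isBilinear.Build F 'cV[F]_n 'cV[F]_n
  'cV[F]_n *:%R *:%R evo_mul evo_mul_bilinear.

Definition evo_alg : naAlgebra F := @NaAlgebra F 'cV[F]_n evo_mul.

Definition evo_basis (j : 'I_n) : evo_alg := (delta_mx j 0 : 'cV[F]_n).

Lemma evo_basis_mul (i j : 'I_n) :
  mul (evo_basis i) (evo_basis j) =
    (if i == j then \sum_k W k i *: evo_basis k else 0) :> evo_alg.
Proof.
apply/colP=> k; rewrite /= /evo_mul !mxE.
have -> : (if i == j then \sum_k0 W k0 i *: evo_basis k0 else 0) k 0 =
          (i == j)%:R * W k i.
  case: (i == j); last by rewrite mul0r mxE.
  rewrite mul1r summxE (bigD1 k) //= !mxE !eqxx mulr1 big1 ?addr0 // => l nlk.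
  by rewrite !mxE eq_sym (negPf nlk) mulr0.
rewrite (bigD1 i) //= !mxE !eqxx mul1r big1 ?addr0 => [|l nli].
  by rewrite andbT mulrC.
by rewrite !mxE (negPf nli) mul0r mulr0.
Qed.

End EvolutionMatrix.

Section EvolutionAlgebra.
Variables (F : fieldType) (A : naAlgebra F).
Implicit Types (U V : {vspace A}).

Definition natural_basis (b : seq A) : Prop :=
  basis_of fullv b /\ {in b &, forall x y, x != y -> mul x y = 0}.

Definition evolution_algebra : Prop := exists b, natural_basis b.

Definition non_degenerate : Prop :=
  forall x : A, (forall y : A, mul x y = 0 /\ mul y x = 0) -> x = 0.

Definition extending_evolution_subspace U : Prop :=
  exists b s : seq A, [/\ natural_basis b, {subset s <= b} & U = <<s>>%VS].

(* Spanned by the products of two bases, hence by all products (mul_spaceP). *)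
Definition mul_space U V : {vspace A} :=
  <<[seq mul x y | x <- vbasis U, y <- vbasis V]>>%VS.

Lemma mul_spaceP U V (Z : {vspace A}) :
  (mul_space U V <= Z)%VS <->
  (forall x y, x \in U -> y \in V -> mul x y \in Z).
Proof.
split=> [sUVZ x y /coord_vbasis -> /coord_vbasis -> | UVZ]; last first.
  apply/span_subvP=> _ /allpairsP[[x y] /= [xU yV ->]].
  by apply: UVZ; apply: vbasis_mem.
rewrite linear_sumr; apply: memv_suml => i _.
rewrite linear_sumlz; apply: memv_suml => j _.
rewrite linearZl_LR linearZr_LR !memvZ //; apply: subvP sUVZ _ _.
by apply/memv_span/allpairsP; exists ((vbasis U)`_j, (vbasis V)`_i);
  split; rewrite ?mem_nth ?size_tuple.
Qed.

Definition evolution_decomposition (r : nat) (E : 'I_r -> {vspace A}) : Prop :=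
  [/\ directv (\sum_(j < r) E j),
      (\sum_(j < r) E j)%VS = fullv,
      forall j, extending_evolution_subspace (E j),
      forall j, \dim (mul_space (E j) (E j)) = 1%N &
      forall j k, j != k ->
        mul_space (E j) (E k) = 0%VS /\
        \dim (mul_space (E j) (E j) + mul_space (E k) (E k)) = 2%N].

(* The decomposition of a non-degenerate evolution algebra exists and is unique
   up to order, so both delta-index and Delta-trace are given as relations. *)
Definition delta_index (d : seq nat) : Prop :=
  sorted geq d /\
  exists E : 'I_(size d) -> {vspace A}, evolution_decomposition E /\
    (forall j, \dim (E j) = nth 0 d j)%N.

Section ProjectedProduct.
Variables U V : {vspace A}.

Definition proj_mul (x y : subvs_of U) : subvs_of U :=
  vsproj U (daddv_pi U V (mul (vsval x) (vsval y))).

Lemma proj_mul_bilinear : bilinear_for *:%R *:%R proj_mul.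
Proof.
by split=> z a x y; rewrite /proj_mul !(linearP, linearPl, linearPr).
Qed.

HB.instance Definition _ := bilinear_isBilinear.Build F (subvs_of U)
  (subvs_of U) (subvs_of U) *:%R *:%R proj_mul proj_mul_bilinear.

(* U with the product of A projected onto U along V. *)
Definition proj_alg : naAlgebra F := @NaAlgebra F (subvs_of U) proj_mul.

End ProjectedProduct.

Definition component (r : nat) (E : 'I_r -> {vspace A}) (j : 'I_r) : naAlgebra F :=
  proj_alg (E j) (\sum_(k < r | k != j) E k)%VS.

End EvolutionAlgebra.

Arguments delta_index {F} A d.
Arguments evolution_algebra {F} A.
Arguments non_degenerate {F} A.

(* tO m, tE m and tI m stand for O_m, E_m and I_m. *)
Inductive block_type := tO of nat | tE of nat | tI of nat.

Definition block_dim (t : block_type) : nat :=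
  match t with tO m | tE m | tI m => m end.

Definition block_rank (t : block_type) : nat :=
  match t with tO _ => 0 | tE _ => 1 | tI _ => 2 end.

(* I_m only exists for m >= 2. *)
Definition block_valid (t : block_type) : bool :=
  match t with tI m => (1 < m)%N | _ => true end.

Definition block_le (t u : block_type) : bool :=
  (block_dim u < block_dim t)%N ||
  (block_dim t == block_dim u) && (block_rank t <= block_rank u)%N.

Definition block_alg (F : fieldType) (imag : F) (t : block_type) : naAlgebra F :=
  match t with
  | tO m => evo_alg (0 : 'M[F]_m)
  | tE m => evo_alg (\matrix_(k < m, j < m) (k == 0 :> nat)%:R : 'M[F]_m)
  | tI m => evo_alg (\matrix_(k < m, j < m)
                       ((k == 0 :> nat)%:R + imag * (k == 1 :> nat)%:R) : 'M[F]_m)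
  end.

Definition Delta_trace (F : fieldType) (imag : F) (A : naAlgebra F)
    (t : seq block_type) : Prop :=
  [/\ sorted block_le t, all block_valid t &
      exists E : 'I_(size t) -> {vspace A}, evolution_decomposition E /\
        forall j, isomorphic (component E j)
                             (block_alg imag (nth (tO 0) t j))].

Inductive listed (F : Type) :=
| A31 of F & F & F
| A32 of F
| A33 of F & F & F & F
| A34 of F & F & F
| A35 of F & F
| A36 of F & F & F & F & F
| A37 of F & F & F & F & F & F
| B31
| B32
| B33 of F
| B34
| B35 of F & F
| B36 of F
| B37 of F & F & F
| B38 of F
| B39 of bool (* true for the sign +, false for the sign - *)
| B310
| B311
| B312 of F & F
| B313 of F
| B314
| B315 of F
| E3
| I3.

Arguments B31 {F}.
Arguments B32 {F}.
Arguments B34 {F}.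
Arguments B39 {F} _.
Arguments B310 {F}.
Arguments B311 {F}.
Arguments B314 {F}.
Arguments E3 {F}.
Arguments I3 {F}.

Definition mx_of_rows (F : fieldType) (rows : seq (seq F)) : 'M[F]_3 :=
  \matrix_(k < 3, j < 3) (nth [::] rows k)`_j.

Definition listed_mx (F : fieldType) (imag : F) (x : listed F) : 'M[F]_3 :=
  mx_of_rows
  match x with
  | A31 a b c => [:: [:: 0; 1; a];
                     [:: b; 0; 1];
                     [:: 1; c; 0]]
  | A32 a => [:: [:: 0; 0; 0];
                 [:: a; 0; 1];
                 [:: 1; 1; 0]]
  | A33 a b c e => [:: [:: 0; a; b];
                       [:: c; 0; e];
                       [:: 1; 1; 1]]
  | A34 a b c => [:: [:: 0; a; b];
                     [:: 1; 0; c];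
                     [:: 0; 1; 1]]
  | A35 a b => [:: [:: 0; 1; a];
                   [:: 1; 0; b];
                   [:: 0; 0; 1]]
  | A36 a b c e z => [:: [:: 0; a; b];
                         [:: 1; 1; c];
                         [:: e; z; 1]]
  | A37 a b c e z x => [:: [:: 1; a; b];
                           [:: c; 1; e];
                           [:: z; x; 1]]
  | B31 => [:: [:: 0; 0; 0];
               [:: 0; 0; 1];
               [:: 1; 1; 0]]
  | B32 => [:: [:: 0; 0; 1];
               [:: 0; 0; imag];
               [:: 1; 1; 0]]
  | B33 a => [:: [:: 0; 0; 0];
                 [:: 0; 0; 1];
                 [:: a; a; 1]]
  | B34 => [:: [:: 0; 0; 1];
               [:: 0; 0; imag];
               [:: 1; 1; 1]]
  | B35 a b => [:: [:: 1; 1; a];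
                   [:: 0; 0; b];
                   [:: 1; 1; 0]]
  | B36 a => [:: [:: 1; 1; a];
                 [:: 0; 0; 1];
                 [:: 0; 0; 0]]
  | B37 a b c => [:: [:: 1; 1; b];
                     [:: 0; 0; c];
                     [:: a; a; 1]]
  | B38 a => [:: [:: 1; 1; a];
                 [:: imag; imag; 0];
                 [:: 1; 1; 0]]
  | B39 s => [:: [:: 1; 1; 1];
                 [:: imag; imag; if s then imag else - imag];
                 [:: 1; 1; 0]]
  | B310 => [:: [:: 1; 1; 1];
                [:: imag; imag; 0];
                [:: 0; 0; 0]]
  | B311 => [:: [:: 1; 1; 1];
                [:: imag; imag; - imag];
                [:: 0; 0; 0]]
  | B312 a b => [:: [:: 1; 1; a];
                    [:: imag; imag; b];
                    [:: 1; 1; 1]]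
  | B313 a => [:: [:: 1; 1; a];
                  [:: imag; imag; 0];
                  [:: 0; 0; 1]]
  | B314 => [:: [:: 1; 1; 1];
                [:: imag; imag; imag];
                [:: 0; 0; 1]]
  | B315 a => [:: [:: 1; 1; a];
                  [:: imag; imag; - a * imag];
                  [:: 0; 0; 1]]
  | E3 => [:: [:: 1; 1; 1];
              [:: 0; 0; 0];
              [:: 0; 0; 0]]
  | I3 => [:: [:: 1; 1; 1];
              [:: imag; imag; imag];
              [:: 0; 0; 0]]
  end.

Definition listed_alg (F : fieldType) (imag : F) (x : listed F) : naAlgebra F :=
  evo_alg (listed_mx imag x).

Definition listed_delta (F : Type) (x : listed F) : seq nat :=
  match x with
  | A31 _ _ _ | A32 _ | A33 _ _ _ _ | A34 _ _ _ | A35 _ _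
  | A36 _ _ _ _ _ | A37 _ _ _ _ _ _ => [:: 1; 1; 1]
  | E3 | I3 => [:: 3]
  | _ => [:: 2; 1]
  end%N.

(* The delta-index only makes sense for a non-degenerate algebra: for instance
   the value 0 of the parameter of B33 is excluded. *)
Definition admissible (F : fieldType) (imag : F) (x : listed F) : Prop :=
  [/\ non_degenerate (listed_alg imag x),
      delta_index (listed_alg imag x) (listed_delta x) &
      match x with B313 a => a != 0 | _ => True end].

Definition represented_by (F : fieldType) (imag : F) (A : naAlgebra F)
    (x : listed F) : Prop :=
  admissible imag x /\ isomorphic A (listed_alg imag x).

Definition same_family (F : Type) (x y : listed F) : Prop :=
  match x, y with
  | A31 _ _ _, A31 _ _ _
  | A32 _, A32 _
  | A33 _ _ _ _, A33 _ _ _ _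
  | A34 _ _ _, A34 _ _ _
  | A35 _ _, A35 _ _
  | A36 _ _ _ _ _, A36 _ _ _ _ _
  | A37 _ _ _ _ _ _, A37 _ _ _ _ _ _
  | B31, B31
  | B32, B32
  | B33 _, B33 _
  | B34, B34
  | B35 _ _, B35 _ _
  | B36 _, B36 _
  | B37 _ _ _, B37 _ _ _
  | B38 _, B38 _
  | B39 _, B39 _
  | B310, B310
  | B311, B311
  | B312 _ _, B312 _ _
  | B313 _, B313 _
  | B314, B314
  | B315 _, B315 _
  | E3, E3
  | I3, I3 => True
  | _, _ => False
  end.

Definition identified (F : fieldType) (x y : listed F) : Prop :=
  match x, y with
  | B35 a b, B35 a' b' => a' = a /\ (b' = b \/ b' = - b)
  | B36 a, B36 a' => a' = a \/ a' = - a
  | B37 a b c, B37 a' b' c' => [/\ a' = a, b' = b & c' = c \/ c' = - c]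
  | _, _ => x = y
  end.

Section BasisPermutation.
Variables (F : fieldType) (V W : 'M[F]_3) (f : 'Hom(evo_alg V, evo_alg W)).

Definition permutes_basis : Prop :=
  exists s : 'S_3, forall j, f (evo_basis V j) = evo_basis W (s j).

Definition permutes_basis_up_to_scalars : Prop :=
  exists (s : 'S_3) (c : 'I_3 -> F),
    forall j, c j != 0 /\ f (evo_basis V j) = c j *: evo_basis W (s j).

End BasisPermutation.

(* Main.v *)
(* Column i of the structure matrix W is e_i^2. If these columns are pairwise
   independent, the off-diagonal products of the columns of a change of natural
   basis lie in ker W, which forces it to be monomial; the normal forms are then
   obtained by rescaling the basis, and counting zero entries of W separates the
   families. If e_1^2 and e_2^2 are proportional to z and independent of
   w = e_3^2, the algebra amounts to the projections of z and w to a plane with a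
   nondegenerate quadratic form, up to similitudes, together with their third
   coordinates. The Gram matrix of the projections and the third coordinates
   separate the families, and similitudes that are diagonal in isotropic
   coordinates give the normal forms. If all squares are proportional to z, only
   the orthogonal orbit of z matters, that is, whether z is isotropic. *)

From Pilot Require Import Defs.
Set Warnings "-notation-overridden,-ambiguous-paths".
From HB Require Import structures.
From mathcomp Require Import all_boot all_order all_fingroup all_algebra.
From mathcomp Require Import ring.

Set Implicit Arguments.
Unset Strict Implicit.
Unset Printing Implicit Defensive.

(* all_algebra contains another [mul]. *)
Import Pilot.Defs.
Import GRing.Theory.
Local Open Scope ring_scope.

(** * Isomorphisms and natural bases *)

(** The delta-index and the Delta-trace speak of some decomposition, perhaps adapted to another
    natural basis than the given one. They are turned into properties that travel along
    isomorphisms: pairwise independence of the columns for (1,1,1), and for (2,1) against (3) the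
    question whether all products lie on one line. The type of a component is read from its
    projected squares: O if they vanish, I if only the squares of squares vanish, E otherwise. On a
    line this is a condition on the diagonal entry; on a plane with e_1^2 = mu e_0^2 it tells
    whether the projection of e_0^2 is zero, isotropic or anisotropic for p^2 + mu q^2. Turning the
    entry (k, j) into 1 by rescaling means c_k = c_j^2 W k j. Along a cycle of n such entries this
    requires a root of order 2^n - 1, whence the seventh and cube roots; a chain ending in a known
    scalar needs square roots only. Families are told apart by a numerical code built from vanishing
    conditions, which avoids comparing them pair by pair. *)

Section Isomorphisms.
Variable F : fieldType.

Lemma isomorphic_refl (A : naAlgebra F) : isomorphic A A.
Proof.
exists \1%VF; split; last by move=> x y; rewrite !id_lfunE.
by exists id => x; rewrite id_lfunE.
Qed.

Lemma isomorphic_sym (A B : naAlgebra F) : isomorphic A B -> isomorphic B A.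
Proof.
move=> [f [bf fM]]; have [g fK gK] := bf.
have kf0 : lker f == 0%VS by apply/lker0P; apply: bij_inj.
have fVK : cancel (f^-1)%VF f.
  by move=> y; rewrite -[y]gK; congr (f _); apply: lker0_lfunK.
exists (f^-1)%VF; split; first by exists f => // x; apply: lker0_lfunK.
by move=> x y; apply: (bij_inj bf); rewrite fM !fVK.
Qed.

Lemma isomorphic_trans (B A C : naAlgebra F) :
  isomorphic A B -> isomorphic B C -> isomorphic A C.
Proof.
move=> [f [bf fM]] [g [bg gM]]; exists (g \o f)%VF; split.
  by apply: (eq_bij (bij_comp bg bf)) => x; rewrite comp_lfunE.
by move=> x y; rewrite !comp_lfunE fM gM.
Qed.

Variable n : nat.
Implicit Types (V W M : 'M[F]_n) (x y : 'cV[F]_n).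

Lemma evo_mulE W x y l :
  evo_mul W x y l 0 = \sum_k W l k * (x k 0 * y k 0).
Proof. by rewrite mxE; apply: eq_bigr => k _; rewrite mxE. Qed.

Lemma isomorphic_of_mx V W M : M \in unitmx ->
  (forall x y, M *m evo_mul V x y = evo_mul W (M *m x) (M *m y)) ->
  isomorphic (evo_alg V) (evo_alg W).
Proof.
move=> Mu MM.
pose f : 'Hom(evo_alg V, evo_alg W) := linfun (mulmx M : evo_alg V -> evo_alg W).
have fE x : f x = M *m x by rewrite lfunE.
exists f; split; last by move=> x y; rewrite !fE; apply: MM.
by exists (mulmx (invmx M)) => x; rewrite fE ?mulKmx ?mulKVmx.
Qed.

Definition hom_mx V W (f : 'Hom(evo_alg V, evo_alg W)) : 'M[F]_n :=
  \matrix_(k, j) (f (evo_basis V j) : 'cV[F]_n) k 0.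

Lemma hom_mxE V W (f : 'Hom(evo_alg V, evo_alg W)) x : f x = hom_mx f *m x.
Proof.
have -> : x = \sum_j x j 0 *: evo_basis V j :> evo_alg V.
  by rewrite [LHS]matrix_sum_delta; apply: eq_bigr => j _; rewrite big_ord1.
rewrite linear_sum /= mulmx_sumr; apply: eq_bigr => j _.
rewrite linearZ /= -scalemxAr; congr (_ *: _).
by rewrite -colE; apply/colP=> k; rewrite !mxE.
Qed.

Lemma hom_mx_unit V W (f : 'Hom(evo_alg V, evo_alg W)) :
  bijective f -> hom_mx f \in unitmx.
Proof.
case=> g fK gK.
pose N : 'M[F]_n := \matrix_(k, j) (g (evo_basis W j) : 'cV[F]_n) k 0.
suff /mulmx1_unit[] : hom_mx f *m N = 1%:M by [].
apply/matrixP=> k j; have := congr1 (fun v : 'cV[F]_n => v k 0) (gK (evo_basis W j)).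
rewrite hom_mxE !mxE eqxx andbT => <-; apply: eq_bigr => i _; by rewrite !mxE.
Qed.

(** For i != j this says that the entrywise product of columns i and j of [hom_mx f] lies in the
    kernel of [W]. *)
Lemma hom_mx_mul V W (f : 'Hom(evo_alg V, evo_alg W)) : is_algebra_iso f ->
  forall i j l, (i == j)%:R * (\sum_k hom_mx f l k * V k i) =
    \sum_k W l k * (hom_mx f k i * hom_mx f k j).
Proof.
move=> [_ fM] i j l.
have := congr1 (fun v : 'cV[F]_n => v l 0) (fM (evo_basis V i) (evo_basis V j)).
rewrite !hom_mxE evo_basis_mul /= => e.
transitivity ((evo_mul W (hom_mx f *m evo_basis V i)
  (hom_mx f *m evo_basis V j)) l 0).
  rewrite -e; case: eqP => _; last by rewrite mul0r linear0 mxE.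
  rewrite mul1r mxE; apply: eq_bigr => k _; congr (_ * _).
  rewrite summxE (bigD1 k) //= !mxE !eqxx mulr1 big1 ?addr0 // => m nmk.
  by rewrite !mxE eq_sym (negPf nmk) mulr0.
rewrite mxE; apply: eq_bigr => k _; rewrite mxE.
by rewrite /evo_basis -!colE !mxE.
Qed.
End Isomorphisms.

Lemma isomorphic_of_natural_basis (F : fieldType) (A : naAlgebra F) (n : nat)
    (b : n.-tuple A) : basis_of fullv b ->
  (forall i j : 'I_n, i != j -> mul b`_i b`_j = 0) ->
  isomorphic A (evo_alg (\matrix_(k < n, j < n) coord b k (mul b`_j b`_j))).
Proof.
move=> bB b0; have fb := basis_free bB.
set W := (\matrix_(k, j) _ : 'M[F]_n).
pose f (x : A) : evo_alg W := \col_k coord b k x.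
have flin : linear f by move=> a x y; apply/colP=> k; rewrite !mxE linearP.
pose fl : {linear A -> evo_alg W} :=
  HB.pack f (GRing.isLinear.Build F A (evo_alg W) *:%R f flin).
exists (linfun fl).
have fE x : linfun fl x = \col_k coord b k x :> 'cV_n by rewrite lfunE.
have xE (x : A) : x = \sum_(i < n) coord b i x *: b`_i.
  by apply: (coord_basis bB (memvf x)).
split.
  exists (fun y : 'cV[F]_n => \sum_i y i 0 *: b`_i) => [x | y].
    by rewrite fE [RHS]xE; apply: eq_bigr => i _; rewrite mxE.
  by rewrite fE; apply/colP=> k; rewrite mxE coord_sum_free.
move=> x y; rewrite !fE /=; apply/colP=> k; rewrite !mxE.
rewrite {1}[x]xE {1}[y]xE linear_sumlz linear_sum /=; apply: eq_bigr => i _.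
rewrite linearZl_LR linear_sumr (bigD1 i) //= big1 => [|j ji].
  by rewrite addr0 linearZr_LR !linearZ /= !mxE; ring.
by rewrite linearZr_LR b0 ?scaler0 // eq_sym.
Qed.

(** A basis vector of square 0 kills the whole basis, hence lies in the annihilator. *)
Lemma natural_basis_sq_neq0 (F : fieldType) (A : naAlgebra F) (n : nat)
    (b : n.-tuple A) (j : 'I_n) : basis_of fullv b ->
  (forall i j : 'I_n, i != j -> mul b`_i b`_j = 0) ->
  non_degenerate A -> mul b`_j b`_j != 0.
Proof.
move=> bB b0 A0; have fb := basis_free bB; apply/eqP=> bj0.
have bjn : b`_j \in (b : seq A) by rewrite mem_nth // size_tuple.
have bb (i k : 'I_n) : (i == j) || (k == j) -> mul b`_i b`_k = 0.
  by have [->|/b0//] := eqVneq i k; rewrite orbb => /eqP->.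
have := free_not0 fb bjn; rewrite (A0 b`_j) ?eqxx // => y.
rewrite (coord_basis bB (memvf y)) linear_sumr linear_sumlz.
by split; apply: big1 => i _; rewrite (linearZr_LR, linearZl_LR) bb ?eqxx ?orbT ?scaler0.
Qed.

(** * Algebras with pairwise independent squares *)

Section MonomialChange.
Variables (F : fieldType).

(** The map e_j -> c_j e_(s j). The second hypothesis compares the coefficients of e_(s k) in the
    image of e_j^2 and in the square of the image of e_j. *)
Lemma isomorphic_monomial n (V W : 'M[F]_n) (s : 'S_n) (c : 'I_n -> F) :
  (forall j, c j != 0) ->
  (forall k j, c k * V k j = c j ^+ 2 * W (s k) (s j)) ->
  isomorphic (evo_alg V) (evo_alg W).
Proof.
move=> c0 VW; pose M : 'M[F]_n := \matrix_(k, j) ((k == s j)%:R * c j).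
pose N : 'M[F]_n := \matrix_(j, k) ((k == s j)%:R / c j).
have ME (x : 'cV[F]_n) k : (M *m x) (s k) 0 = c k * x k 0.
  rewrite mxE (bigD1 k) //= !mxE eqxx mul1r big1 ?addr0 // => j jk.
  by rewrite !mxE (inj_eq perm_inj) eq_sym (negPf jk) !mul0r.
apply: (@isomorphic_of_mx _ _ _ _ M) => [|x y].
  suff /mulmx1_unit[] : N *m M = 1%:M by [].
  apply/matrixP=> i j; rewrite !mxE (bigD1 (s i)) //= !mxE eqxx mul1r big1.
    rewrite addr0 (inj_eq perm_inj); case: eqP => [->|_].
      by rewrite mul1r mulVf.
    by rewrite mul0r mulr0.
  by move=> l ls; rewrite !mxE (negPf ls) !mul0r.
apply/colP=> k; rewrite -(permKV s k) ME; move: (_ k) => {}k.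
rewrite !evo_mulE mulr_sumr [RHS](reindex_inj (@perm_inj _ s)) /=.
by apply: eq_bigr => j _; rewrite !ME mulrA VW; ring.
Qed.

Definition indep_col n (W : 'M[F]_n) i j := forall a b : F,
  (forall k, a * W k i + b * W k j = 0) -> a = 0 /\ b = 0.

Definition indep_cols n (W : 'M[F]_n) := forall i j, i != j -> indep_col W i j.

Definition monomial_mx n (M : 'M[F]_n) (s : 'S_n) :=
  forall k j, (M k j == 0) = (k != s j).

(** Columns are nonzero and rows have at most one nonzero entry, so picking a nonzero entry in each
    column is injective. *)
Lemma monomial_of_prod0 n (M : 'M[F]_n) : M \in unitmx ->
  (forall i j, i != j -> forall k, M k i * M k j = 0) ->
  exists s, monomial_mx M s.
Proof.
move=> Mu M0.
have /fin_all_exists[h hP] j : exists k, M k j != 0.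
  apply/existsP; apply: contraLR Mu; rewrite negb_exists => /forallP e.
  rewrite unitmxE (expand_det_col _ j) big1 ?unitr0 // => k _.
  by move: (e k); rewrite negbK => /eqP->; rewrite mul0r.
have hM k i j : M k i != 0 -> M k j != 0 -> i = j.
  move=> ki kj; apply/eqP/negPn/negP => ij.
  by move/eqP: (M0 i j ij k); rewrite mulf_eq0 (negPf ki) (negPf kj).
have h_inj : injective h by move=> i j e; apply: (hM (h i)); rewrite // e.
exists (perm h_inj) => k j; rewrite permE.
apply/idP/idP => [/eqP kj|]; first by apply/eqP=> e; case/eqP: (hP j); rewrite -e.
apply: contraNT => kj.
have [i ik] : exists i, k = h i.
  by exists ((perm h_inj)^-1%g k); rewrite -permE permKV.
by rewrite ik in kj *; rewrite (hM _ _ _ (hP i) kj).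
Qed.
End MonomialChange.

Lemma third_index (i j : 'I_3) : i != j -> exists2 k : 'I_3, i != k & j != k.
Proof.
(* The three indices sum to 0 modulo 3. *)
by move=> ij; exists (- (i + j));
  move: i j ij => [[|[|[|?]]] ?] [[|[|[|?]]] ?].
Qed.

Section Uniqueness.
Variables (F : fieldType) (W : 'M[F]_3).
Hypothesis Wi : indep_cols W.

Let kerW (u : 'cV[F]_3) := forall l, \sum_k W l k * u k 0 = 0.

(** A kernel vector with a zero entry is a relation between the two remaining columns. *)
Lemma ker_indep_cols u i : kerW u -> u i 0 = 0 -> u = 0.
Proof.
move=> uW ui.
have e (j k : 'I_3) : i != j -> i != k -> j != k -> u j 0 = 0 /\ u k 0 = 0.
  move=> ij ik jk; apply: (Wi jk) => l.
  have := uW l; rewrite (bigD1 i) //= (bigD1 j) /= 1?eq_sym // (bigD1 k) /=; last first.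
    by rewrite ![k == _]eq_sym ik jk.
  rewrite big1 => [|m /andP[/andP[mi mj] mk]].
    by rewrite ui mulr0 add0r addr0 ![u _ 0 * _]mulrC.
  have : uniq [:: i; j; k; m].
    by rewrite /= !inE !negb_or ij ik jk ![_ == m]eq_sym mi mj mk.
  by move/card_uniqP => c; have := max_card [in [:: i; j; k; m]]; rewrite c card_ord.
apply/colP=> j; rewrite mxE; have [->//|ji] := eqVneq j i.
have [k jk ik] := third_index ji.
by have [] := e j k; rewrite // eq_sym.
Qed.

Lemma ker_indep_cols_all u i : kerW u -> u i 0 != 0 -> forall k, u k 0 != 0.
Proof.
by move=> uW ui k; apply: contraNneq ui => /(ker_indep_cols uW)->; rewrite mxE.
Qed.

Lemma monomial_of_ker (M : 'M[F]_3) : M \in unitmx ->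
  (forall i j, i != j -> kerW (\col_k (M k i * M k j))) ->
  exists s, monomial_mx M s.
Proof.
(* A nonzero vector of ker W has no zero entry, and ker W is at most a line. If
   some M k i * M k j is nonzero, then columns j and m of M are therefore
   proportional. *)
move=> Mu MW; apply: monomial_of_prod0 => // i j ij k; apply/eqP/negPn/negP => Mk.
have Mk' l : (M l i != 0) && (M l j != 0).
  have := ker_indep_cols_all (MW i j ij) (i := k); rewrite mxE => /(_ Mk l).
  by rewrite mxE mulf_eq0 negb_or.
have Mker (v : 'cV_3) : M *m v = 0 -> v = 0.
  by move=> Mv; rewrite -[v](mulKmx Mu) Mv mulmx0.
have [m im jm] := third_index ij.
(* This [t] cancels entry [k] of the next kernel vector, which therefore vanishes altogether. *)
pose t := M k m / M k j.
have kker : kerW (\col_l (M l i * (M l m - t * M l j))).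
  have MWE l i' j' : i' != j' -> \sum_x W l x * (M x i' * M x j') = 0.
    by move=> /MW/(_ l) e; rewrite -[RHS]e; apply: eq_bigr => x _; rewrite mxE.
  move=> l; have e1 := MWE l i j ij; have e2 := MWE l i m im.
  transitivity (\sum_k W l k * (M k i * M k m) -
                t * \sum_k W l k * (M k i * M k j)).
    by rewrite mulr_sumr -sumrB; apply: eq_bigr => x _; rewrite mxE; ring.
  by rewrite e1 e2 mulr0 subr0.
have := ker_indep_cols kker (i := k).
rewrite mxE /t divfK; last by case/andP: (Mk' k).
rewrite subrr mulr0 => /(_ erefl)/colP e.
suff /colP/(_ m) : delta_mx m 0 - t *: delta_mx j 0 = 0 :> 'cV[F]_3.
  rewrite !mxE eqxx eq_sym (negPf jm) mulr0 subr0; apply/eqP/oner_neq0.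
apply: Mker; rewrite mulmxBr -scalemxAr -!colE; apply/colP=> l.
move: (e l); rewrite !mxE => /eqP; rewrite mulf_eq0 (negPf (andP (Mk' l)).1) /=.
by move/eqP.
Qed.

Lemma monomial_iso (V : 'M[F]_3) (f : 'Hom(evo_alg V, evo_alg W)) :
  is_algebra_iso f -> exists s, monomial_mx (hom_mx f) s.
Proof.
move=> fi; apply: monomial_of_ker => [|i j ij l].
  by apply: hom_mx_unit; case: fi.
have := hom_mx_mul fi i j l; rewrite (negPf ij) mul0r => /esym e.
by rewrite -[RHS]e; apply: eq_bigr => k _; rewrite mxE.
Qed.

(** Converse of [isomorphic_monomial]: coefficient of e_(s k) in f (e_j^2) = (f e_j)^2. *)
Lemma monomial_iso_entries (V : 'M[F]_3) (f : 'Hom(evo_alg V, evo_alg W)) s :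
    is_algebra_iso f -> monomial_mx (hom_mx f) s ->
  forall k j, hom_mx f (s k) k * V k j = hom_mx f (s j) j ^+ 2 * W (s k) (s j).
Proof.
move=> fi fs k j; have := hom_mx_mul fi j j (s k).
have f0 i l : i != l -> hom_mx f (s i) l = 0.
  by move=> il; apply/eqP; rewrite fs (inj_eq perm_inj).
rewrite eqxx mul1r (bigD1 k) //= big1 ?addr0 => [->|l lk]; last first.
  by rewrite f0 ?mul0r // eq_sym.
rewrite (bigD1 (s j)) //= big1 ?addr0 => [|l lj]; first by ring.
by rewrite -(permKV s l) in lj *; rewrite f0 ?mulr0 ?mul0r // -(inj_eq (@perm_inj _ s)).
Qed.

(** The isomorphism is monomial, so a relation between two columns of [V] rescales to one between
    two columns of [W]. *)
Lemma indep_cols_iso (V : 'M[F]_3) :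
  isomorphic (evo_alg V) (evo_alg W) -> indep_cols V.
Proof.
move=> [f fi]; have [s fs] := monomial_iso fi.
have VW := monomial_iso_entries fi fs.
have f0 j : hom_mx f (s j) j != 0 by rewrite fs negbK.
move=> i j ij a b ab.
have sij : s i != s j by rewrite (inj_eq perm_inj).
have [|/eqP + /eqP] :=
    @Wi _ _ sij (a * hom_mx f (s i) i ^+ 2) (b * hom_mx f (s j) j ^+ 2).
  move=> k; rewrite -(permKV s k) -(mulrA a) -(mulrA b) -!VW; move: (_ k) => {}k.
  by rewrite mulrCA [b * _]mulrCA -mulrDr ab mulr0.
by rewrite !mulf_eq0 !(negPf (f0 _)) !orbF => /eqP-> /eqP->.
Qed.
End Uniqueness.

(** * Decompositions into coordinate blocks *)

Section BlockDecomposition.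
Variables (F : fieldType) (n : nat) (W : 'M[F]_n).

Lemma evo_mul_basisE (x : 'cV[F]_n) j k :
  evo_mul W x (evo_basis W j) k 0 = W k j * x j 0.
Proof.
rewrite evo_mulE (bigD1 j) //= big1 => [|l lj]; first by rewrite !mxE !eqxx addr0 mulr1.
by rewrite !mxE (negPf lj) !mulr0.
Qed.

Lemma evo_non_degenerate :
  (forall j, exists k, W k j != 0) -> non_degenerate (evo_alg W).
Proof.
move=> W0 x x0; apply/colP=> j; rewrite mxE; have [k Wk] := W0 j.
have /colP/(_ k)/eqP := (x0 (evo_basis W j)).1.
by rewrite /= evo_mul_basisE mxE mulf_eq0 (negPf Wk) => /eqP.
Qed.

Lemma evo_natural_basis :
  natural_basis [seq evo_basis W i | i <- enum 'I_n].
Proof.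
split; last first.
  move=> _ _ /mapP[i _ ->] /mapP[j _ ->] ij; rewrite evo_basis_mul.
  by have [e|//] := eqVneq i j; rewrite e eqxx in ij.
rewrite basisEdim size_map size_enum_ord dimvf.
have -> : dim (evo_alg W) = n by rewrite -[RHS]muln1; apply: dim_matrix.
rewrite leqnn andbT.
apply/subvP=> x _.
have -> : x = \sum_j (x : 'cV_n) j 0 *: evo_basis W j.
  by rewrite [LHS]matrix_sum_delta; apply: eq_bigr => j _; rewrite big_ord1.
apply: memv_suml => j _; apply/memvZ/memv_span/map_f; exact: mem_enum.
Qed.

Variables (r : nat) (h : 'I_n -> 'I_r).

Definition coord_block j : {vspace evo_alg W} :=
  <<[seq evo_basis W i | i <- enum 'I_n & h i == j]>>%VS.

Lemma mem_coord_block i : evo_basis W i \in coord_block (h i).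
Proof. by apply/memv_span/map_f; rewrite mem_filter eqxx mem_enum. Qed.

Lemma coord_block0 (x : evo_alg W) j : x \in coord_block j ->
  forall i, h i != j -> (x : 'cV_n) i 0 = 0.
Proof.
move=> xj i ij; pose ev (y : evo_alg W) : F^o := (y : 'cV_n) i 0.
have evl : linear ev by move=> a u v; rewrite /ev !mxE.
pose g : {linear evo_alg W -> F^o} :=
  HB.pack ev (GRing.isLinear.Build F (evo_alg W) F^o *:%R ev evl).
suff /subvP/(_ x xj) : (coord_block j <= lker (linfun g))%VS.
  by rewrite memv_ker lfunE => /eqP.
apply/span_subvP=> _ /mapP[l + ->]; rewrite mem_filter => /andP[/eqP hl _].
rewrite memv_ker lfunE /= /ev mxE.
by have [e|//] := eqVneq i l; rewrite e hl eqxx in ij.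
Qed.

Variables (zeta : 'I_r -> 'cV[F]_n) (mu : 'I_n -> F).
Hypothesis hsurj : forall j, exists i, h i = j.
Hypothesis mu0 : forall i, mu i != 0.
Hypothesis Wmu : forall i, col i W = mu i *: zeta (h i).
Hypothesis zeta_free : forall j k, j != k ->
  free [:: (zeta j : evo_alg W); zeta k].
Hypothesis zeta0 : forall j, zeta j != 0.

Lemma dim_coord_block j : \dim (coord_block j) = #|[pred i | h i == j]|.
Proof.
have [/basis_free fb _] := evo_natural_basis.
have : free [seq evo_basis W i | i <- enum 'I_n & h i == j].
  apply: (@catl_free _ _ [seq evo_basis W i | i <- enum 'I_n & h i != j]).
  by rewrite -map_cat (perm_free (perm_map _ (permEl (perm_filterC _ _)))).
move=> /eqP ->; rewrite size_map -sum1_size big_filter big_enum_cond /=.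
by rewrite -sum1_card; apply: eq_bigl.
Qed.

(** The square of each basis vector of the block is a nonzero multiple of [zeta j]. *)
Lemma mul_coord_block j : mul_space (coord_block j) (coord_block j) =
  <[zeta j : evo_alg W]>%VS.
Proof.
apply/eqP; rewrite eqEsubv; apply/andP; split.
  apply/mul_spaceP => x y xj yj; apply/vlineP.
  exists (\sum_(i | h i == j) mu i * ((x : 'cV_n) i 0 * (y : 'cV_n) i 0)).
  apply/colP=> k; rewrite /= evo_mulE !mxE mulr_suml [RHS]big_mkcond /=.
  apply: eq_bigr => i _; case: eqP => [<-|/eqP ij].
    by move/colP/(_ k): (Wmu i); rewrite !mxE => ->; ring.
  by rewrite (coord_block0 xj ij) mul0r mulr0.
have [i <-] := hsurj j; rewrite -memvE.
have -> : zeta (h i) = (mu i)^-1 *: mul (evo_basis W i) (evo_basis W i).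
  apply/colP=> k; rewrite mxE evo_mul_basisE mxE !eqxx mulr1.
  by move/colP/(_ k): (Wmu i); rewrite !mxE => ->; rewrite mulKf.
apply/memvZ; move: (mul_spaceP (coord_block (h i)) (coord_block (h i))
  (mul_space (coord_block (h i)) (coord_block (h i)))).1 => /(_ (subvv _)).
by apply; apply: mem_coord_block.
Qed.

(** The decomposition of a concrete matrix: blocks are classes of parallel columns, and [zeta] gives
    their directions. *)
Lemma evolution_decomposition_blocks : evolution_decomposition coord_block.
Proof.
split.
- apply/directv_sum_independent => u uB u0 j _; apply/colP=> i; rewrite mxE.
  have [<-|hij] := eqVneq (h i) j; last exact: coord_block0 (uB j isT) _ hij.
  have /colP/(_ i) := u0; rewrite summxE mxE (bigD1 (h i)) //= big1 ?addr0 // => k ik.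
  by apply: coord_block0 (uB k isT) _ _; rewrite eq_sym.
- apply/eqP; rewrite eqEsubv subvf /=.
  have [/span_basis <- _] := evo_natural_basis.
  apply/span_subvP => _ /mapP[i _ ->].
  by apply: (subvP (sumv_sup (h i) _ (subvv _))) => //; apply: mem_coord_block.
- move=> j; exists [seq evo_basis W i | i <- enum 'I_n].
  exists [seq evo_basis W i | i <- enum 'I_n & h i == j]; split => //.
    exact: evo_natural_basis.
  by move=> _ /mapP[i _ ->]; apply/map_f; rewrite mem_enum.
- by move=> j; rewrite mul_coord_block dim_vline zeta0.
move=> j k jk; split.
  apply/eqP; rewrite -subv0; apply/mul_spaceP=> x y xj yk; rewrite memv0.
  apply/eqP/colP=> l; rewrite /= evo_mulE mxE big1 // => i _.
  have [hi|hi] := eqVneq (h i) j.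
    by rewrite (coord_block0 yk) ?mulr0 // hi.
  by rewrite (coord_block0 xj) ?mul0r ?mulr0.
rewrite !mul_coord_block -!span_seq1 -span_cat.
exact/eqP/(zeta_free jk).
Qed.

End BlockDecomposition.

(** * Components of a decomposition *)

Section ComponentTypes.
Variable F : fieldType.


Lemma dim_isomorphic_le (A B : naAlgebra F) :
  isomorphic A B -> (\dim {:A} <= \dim {:B})%N.
Proof.
move=> [f [/bij_inj/lker0P/eqP k0 _]].
by rewrite -(limg_dim_eq (f := f)) ?k0 ?capv0 // dimvS ?subvf.
Qed.

Lemma dim_isomorphic (A B : naAlgebra F) :
  isomorphic A B -> \dim {:A} = \dim {:B}.
Proof.
move=> AB; apply/eqP; rewrite eqn_leq !dim_isomorphic_le //.
exact: isomorphic_sym.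
Qed.

Definition sq (A : naAlgebra F) (x : A) : A := mul x x.

Lemma sq_iso (A B : naAlgebra F) (f : 'Hom(A, B)) x :
  is_algebra_iso f -> f (sq x) = sq (f x).
Proof. by move=> [_ fM]; rewrite /sq fM. Qed.

(* The products of O_m are 0, I_m has nonzero products but z z = 0 for the vector
   z spanning its square, and e_1 is idempotent in E_m. *)
Definition block_squares (t : block_type) (A : naAlgebra F) :=
  match t with
  | tO _ => forall x : A, sq x = 0
  | tE m => (0 < m)%N -> exists x : A, sq (sq x) != 0
  | tI m => (1 < m)%N ->
      (exists x : A, sq x != 0) /\ (forall x : A, sq (sq x) = 0)
  end.

Lemma block_squares_iso t (A B : naAlgebra F) :
  isomorphic A B -> block_squares t B -> block_squares t A.
Proof.
move=> [f fi]; have [[g fK gK] _] := fi.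
have f0 x : (f x == 0) = (x == 0).
  by rewrite -(inj_eq (can_inj fK)) linear0.
case: t => m /=.
- by move=> B0 x; apply/eqP; rewrite -f0 sq_iso // B0.
- move=> + m0 => /(_ m0)[y y0]; exists (g y).
  by rewrite -f0 !sq_iso // gK.
- move=> + m1 => /(_ m1)[[y y0] B0]; split.
    by exists (g y); rewrite -f0 sq_iso // gK.
  by move=> x; apply/eqP; rewrite -f0 !sq_iso // B0.
Qed.

Lemma block_algP (imag : F) t : imag ^+ 2 = -1 -> block_squares t (block_alg imag t).
Proof.
move=> imag2; case: t => [m x|[//|m] _|[|[|m]] //= _].
- by rewrite /sq /= /evo_mul mul0mx.
- exists (evo_basis _ ord0); set W := (\matrix_(_, _) _ : 'M[F]_m.+1).
  have sqe : sq (evo_basis W ord0) = evo_basis W ord0.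
    by apply/colP=> k; rewrite /sq /= evo_mul_basisE !mxE !eqxx mulr1 andbT.
  rewrite /= sqe sqe; apply/eqP => /colP/(_ ord0).
  by rewrite !mxE !eqxx; apply/eqP/oner_neq0.
set W := (\matrix_(_, _) _ : 'M[F]_m.+2).
pose z := (\col_k W k 0 : evo_alg W).
have sqE (x : evo_alg W) : sq x = (\sum_k (x : 'cV_m.+2) k 0 ^+ 2) *: z.
  apply/colP=> k; rewrite /sq /= evo_mulE !mxE mulr_suml.
  by apply: eq_bigr => l _; rewrite !mxE mulrC expr2.
have z0 : z != 0.
  apply/eqP => /colP/(_ 0); rewrite !mxE /= mulr0 addr0.
  by apply/eqP/oner_neq0.
split.
  exists (evo_basis W 0); rewrite sqE (bigD1 0) //= big1 => [|i i0].
    by rewrite mxE eqxx expr1n addr0 scale1r.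
  by rewrite mxE (negPf i0) expr0n.
move=> x; rewrite !sqE; move: (\sum_k x k 0 ^+ 2) => a.
(* The squared coordinates of [a *: z] are a^2, -a^2 and zeros. *)
rewrite big_ord_recl big_ord_recl big1 => [|i _].
  by rewrite !mxE /= !(mulr0, mulr1, add0r, addr0) exprMn imag2 mulrN1 subrr scale0r.
by rewrite !mxE /= !(mulr0, addr0) expr0n.
Qed.

Variable A : naAlgebra F.

Lemma mem_mul_space (U V : {vspace A}) x y :
  x \in U -> y \in V -> mul x y \in mul_space U V.
Proof. by move=> xU yV; apply: (mul_spaceP U V _).1 => //; apply: subvv. Qed.

Lemma mul_space0 (U V : {vspace A}) x y :
  mul_space U V = 0%VS -> x \in U -> y \in V -> mul x y = 0.
Proof. by move=> UV0 xU yV; apply/eqP; rewrite -memv0 -UV0 mem_mul_space. Qed.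

(** The spanning list may have repetitions; filtering the natural basis by membership in it gives a
    free list with the same span. *)
Lemma extending_basis (U : {vspace A}) m :
  extending_evolution_subspace U -> \dim U = m ->
  exists2 s : m.-tuple A, basis_of U s &
    {in s &, forall x y, x != y -> mul x y = 0}.
Proof.
move=> [b [s [[bB b0] sb U_s]]] dU.
pose s' := [seq x <- b | x \in s].
have fs : free s' by apply/filter_free/basis_free/bB.
have Us : U = <<s'>>%VS.
  rewrite U_s; apply: eq_span => x; rewrite mem_filter.
  by case xs: (x \in s); rewrite //= sb.
have ss : size s' == m by rewrite -dU Us (eqP fs).
exists (Tuple ss); first by rewrite /basis_of /= Us fs eqxx.
by move=> x y; rewrite !mem_filter => /andP[_ xb] /andP[_ yb]; apply: b0.
Qed.

Variables (r : nat) (E : 'I_r -> {vspace A}).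
Hypothesis EA : evolution_decomposition E.

Definition comp_proj j : 'End(A) := daddv_pi (E j) (\sum_(k < r | k != j) E k)%VS.

Lemma comp_proj_id j x : x \in E j -> comp_proj j x = x.
Proof.
have [/directv_sumP/(_ j isT) dE _ _ _ _] := EA.
by apply: daddv_pi_id.
Qed.

(** The two complementary projections of [x] add up to [x], and the one onto the other summands
    already fixes it. *)
Lemma comp_proj_eq0 j k x : k != j -> x \in E k -> comp_proj j x = 0.
Proof.
have [/directv_sumP/(_ j isT) /= dE _ _ _ _] := EA => kj xk.
set V := (\sum_(k < r | k != j) E k)%VS in dE *.
have xV : x \in V by apply: (subvP (sumv_sup k kj (subvv _))).
have := daddv_pi_add dE (w := x); rewrite (subvP (addvSr _ _)) // => /(_ isT).
rewrite [X in _ + X]daddv_pi_id //; last by rewrite capvC.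
by move=> e; apply: (addIr x); rewrite add0r; apply: e.
Qed.

Lemma component_sq j (x : component E j) :
  vsval (sq x) = comp_proj j (sq (vsval x)).
Proof. by rewrite /sq /= vsprojK ?memv_pi. Qed.

(** This is [block_squares] for the component, stated inside [A] through the projection so as to
    compute with vectors of [A]. *)
Definition comp_squares j t :=
  match t with
  | tO _ => forall x, x \in E j -> comp_proj j (sq x) = 0
  | tE m => (0 < m)%N ->
      exists2 x, x \in E j & comp_proj j (sq (comp_proj j (sq x))) != 0
  | tI m => (1 < m)%N ->
      (exists2 x, x \in E j & comp_proj j (sq x) != 0) /\
      (forall x, x \in E j -> comp_proj j (sq (comp_proj j (sq x))) = 0)
  end.

Lemma component_type (imag : F) j t : imag ^+ 2 = -1 ->
  isomorphic (component E j) (block_alg imag t) ->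
  \dim (E j) = block_dim t /\
  comp_squares j t.
Proof.
move=> imag2 iso_t; split.
  have := dim_isomorphic iso_t; rewrite !dimvf -[dim _]/(\dim (E j)) => ->.
  by case: t {iso_t} => m /=; rewrite -[RHS]muln1; apply: dim_matrix.
have := block_squares_iso iso_t (block_algP t imag2).
have v0 (x : component E j) : (vsval x == 0) = (x == 0) by [].
have vK x : x \in E j -> exists y : component E j, x = vsval y.
  by move=> xj; exists (vsproj (E j) x); rewrite vsprojK.
case: t {iso_t} => m /=.
- by move=> s0 x /vK[y ->]; rewrite -component_sq s0.
- move=> + m0 => /(_ m0)[x x0]; exists (vsval x); first exact: subvsP.
  by rewrite -!component_sq v0.
- move=> + m1 => /(_ m1)[[x x0] s0]; split.
    by exists (vsval x); [exact: subvsP | rewrite -component_sq v0].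
  by move=> y /vK[{}y ->]; rewrite -!component_sq s0.
Qed.

End ComponentTypes.

Local Notation i0 := (@Ordinal 3 0 isT).
Local Notation i1 := (@Ordinal 3 1 isT).
Local Notation i2 := (@Ordinal 3 2 isT).

Lemma ord3_ind (P : 'I_3 -> Prop) : P i0 -> P i1 -> P i2 -> forall i, P i.
Proof.
by move=> ? ? ? [[|[|[|?]]] i_lt] //; rewrite (bool_irrelevance i_lt isT).
Qed.

Lemma sum3E (V : nmodType) (f : 'I_3 -> V) :
  \sum_k f k = f i0 + f i1 + f i2.
Proof.
rewrite !big_ord_recr big_ord0 /= add0r.
by congr (f _ + f _ + f _); apply: val_inj.
Qed.

(** * Structure matrices adapted to a decomposition *)

Section AdaptedBases.
Variables (F : fieldType) (A : naAlgebra F) (r : nat) (E : 'I_r -> {vspace A}).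
Hypothesis EA : evolution_decomposition E.

Lemma square_sub_line j x : \dim (E j) = 1%N -> x \in E j -> x != 0 ->
  E j = <[x]>%VS /\ (mul_space (E j) (E j) <= <[sq x]>)%VS.
Proof.
move=> d1 xj x0; have Ex : E j = <[x]>%VS.
  by apply/esym/eqP; rewrite eqEdim d1 dim_vline x0 andbT -memvE.
split=> //; apply/mul_spaceP => y z; rewrite Ex => /vlineP[a ->] /vlineP[b ->].
by rewrite linearZl_LR linearZr_LR !memvZ ?memv_line.
Qed.

(** The span of [x] and [y] contains the sum of the two squares, of dimension 2. *)
Lemma free_squares j k x y : j != k ->
  (mul_space (E j) (E j) <= <[x]>)%VS -> (mul_space (E k) (E k) <= <[y]>)%VS ->
  forall a b, a *: x + b *: y = 0 -> a = 0 /\ b = 0.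
Proof.
move=> jk xj yk; have [_ _ _ _ /(_ j k jk)[_ d2]] := EA.
have fxy : free [:: x; y].
  rewrite /free eqn_leq dim_span /= -d2 -[[:: x; y]]/([:: x] ++ [:: y]).
  by rewrite span_cat !span_seq1 dimvS ?addvS.
move=> a b ab; have /freeP/(_ (fun i => if i == 0 then a else b)) :=
  fxy : free [tuple x; y].
rewrite !big_ord_recl big_ord0 /= addr0 => /(_ ab) e.
by have := e 0; have := e 1.
Qed.

(** A nonzero vector v of each line gives a natural basis. The projected square of v is [W j j] v,
    so the diagonal shows the type of the component. *)
Lemma decomposition_lines : (forall j, \dim (E j) = 1%N) ->
  exists W : 'M[F]_r, [/\ isomorphic A (evo_alg W), indep_cols W &
    forall j, (comp_squares E j (tO 1) -> W j j = 0) /\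
              (comp_squares E j (tE 1) -> W j j != 0)].
Proof.
move=> d1; have [dE sE _ _ E0] := EA.
have /fin_all_exists[v vP] j : exists x, [/\ x != 0, x \in E j, E j = <[x]>%VS
    & (mul_space (E j) (E j) <= <[sq x]>)%VS].
  have xj := memv_pick (E j); exists (vpick (E j)).
  have x0 : vpick (E j) != 0 by rewrite vpick0 -dimv_eq0 d1.
  by have [] := square_sub_line (d1 j) xj x0.
pose b := [tuple v j | j < r].
have bE (j : 'I_r) : b`_j = v j by rewrite -tnth_nth tnth_mktuple.
have bB : basis_of fullv b.
  rewrite basisEdim -sE (directvP dE) /= size_tuple; apply/andP; split.
    apply/subv_sumP=> j _; have [_ _ -> _] := vP j.
    by rewrite -memvE memv_span // -bE mem_nth ?size_tuple.
  by rewrite (eq_bigr (fun=> 1%N)) => [|j _]; rewrite ?d1 // sum1_card card_ord.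
have b0 (i j : 'I_r) : i != j -> mul b`_i b`_j = 0.
  move=> ij; rewrite !bE; have [_ vi _ _] := vP i; have [_ vj _ _] := vP j.
  exact: mul_space0 (E0 i j ij).1 vi vj.
have := isomorphic_of_natural_basis bB b0; set W := (\matrix_(_, _) _) => AW.
have sqE j : sq (v j) = \sum_k W k j *: v k.
  rewrite -bE /sq [LHS](coord_basis bB (memvf _)).
  by apply: eq_bigr => k _; rewrite mxE -bE.
exists W; split=> [//|i j ij a c ac|j].
  have [_ _ _ si] := vP i; have [_ _ _ sj] := vP j.
  apply: (free_squares ij si sj); rewrite !sqE !scaler_sumr -big_split big1 //=.
  by move=> k _; rewrite !scalerA -scalerDl ac scale0r.
have [vj0 vj Ej _] := vP j.
have psq : comp_proj E j (sq (v j)) = W j j *: v j.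
  rewrite sqE linear_sum (bigD1 j) //= linearZ /= comp_proj_id // big1 ?addr0 //.
  move=> k kj; rewrite linearZ /= (comp_proj_eq0 EA kj) ?scaler0 //.
  by have [] := vP k.
split=> /= [s0 | /(_ isT)[x]].
  by apply/eqP; have /eqP := s0 _ vj; rewrite psq scaler_eq0 (negPf vj0) orbF.
rewrite Ej => /vlineP[p ->]; apply: contraNneq => W0.
have -> : comp_proj E j (sq (p *: v j)) = 0.
  by rewrite /sq linearZl_LR linearZr_LR !linearZ /= psq W0 scale0r !scaler0.
by rewrite /sq linear0 linear0.
Qed.
End AdaptedBases.

(** In a natural basis a, b of the plane, b^2 = mu a^2. The projected square of p a + q b is (p^2 +
    mu q^2) z, where z is the projection of a^2, and [N] is the value of this form at z. So z has
    projected square [N] z, and the type of the component tells whether z is 0, isotropic or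
    anisotropic. *)
Lemma decomposition_plane_line (F : fieldType) (A : naAlgebra F)
    (E : 'I_2 -> {vspace A}) : evolution_decomposition E -> non_degenerate A ->
    \dim (E 0) = 2%N -> \dim (E 1) = 1%N ->
  exists (W : 'M[F]_3) (mu : F), let N := W i0 i0 ^+ 2 + mu * W i1 i0 ^+ 2 in
  [/\ isomorphic A (evo_alg W), mu != 0, forall k, W k i1 = mu * W k i0,
      indep_col W i0 i2 &
      [/\ comp_squares E 0 (tO 2) -> W i0 i0 = 0 /\ W i1 i0 = 0,
      comp_squares E 0 (tE 2) -> N != 0,
      comp_squares E 0 (tI 2) ->
        N = 0 /\ ((W i0 i0 != 0) || (W i1 i0 != 0)),
      comp_squares E 1 (tO 1) -> W i2 i2 = 0 &
      comp_squares E 1 (tE 1) -> W i2 i2 != 0]].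
Proof.
move=> EA A0 d2 d1; have [dE sE xE sqE1 mE0] := EA.
have [s sB s0] := extending_basis (xE 0) d2.
case: s sB s0 => -[|a [|b []]] //= sz sB s0.
have aE : a \in E 0 by apply: (basis_mem sB); rewrite inE eqxx.
have bE : b \in E 0 by apply: (basis_mem sB); rewrite !inE eqxx orbT.
have vE := memv_pick (E 1); set v := vpick (E 1) in vE.
have v0 : v != 0 by rewrite vpick0 -dimv_eq0 d1.
have [Ev mv] := square_sub_line d1 vE v0.
have [ab ba] : mul a b = 0 /\ mul b a = 0.
  have /free_uniq := basis_free sB; rewrite /= inE andbT => nab.
  by split; apply: s0; rewrite ?inE ?eqxx ?orbT // eq_sym.
have m01 x y : x \in E 0 -> y \in E 1 -> mul x y = 0 /\ mul y x = 0.
  by move=> xE0 yE1; split; [apply: mul_space0 (mE0 0 1 isT).1 _ _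
    | apply: mul_space0 (mE0 1 0 isT).1 _ _].
have [av va] := m01 _ _ aE vE; have [bv vb] := m01 _ _ bE vE.
pose B := [tuple a; b; v].
have e1 : lift ord0 ord0 = 1 :> 'I_2 by apply: val_inj.
have BB : basis_of fullv B.
  rewrite basisEdim -sE (directvP dE) /= !big_ord_recl !big_ord0 e1 d2 d1 /= andbT.
  rewrite !addv0 -[E ord0](span_basis sB) Ev -span_seq1 -span_cat; exact: subvv.
have B0 (i j : 'I_3) : i != j -> mul B`_i B`_j = 0.
  by move: i j; do 2![apply: ord3_ind].
have a0 : sq a != 0 := natural_basis_sq_neq0 i0 BB B0 A0.
have b0 : sq b != 0 := natural_basis_sq_neq0 i1 BB B0 A0.
have Ea : mul_space (E 0) (E 0) = <[sq a]>%VS.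
  by apply/esym/eqP; rewrite eqEdim sqE1 dim_vline a0 andbT -memvE mem_mul_space.
have [mu bmu] : exists mu, sq b = mu *: sq a.
  by apply/vlineP; rewrite -Ea mem_mul_space.
have mu0 : mu != 0 by apply: contraNneq b0; rewrite bmu => ->; rewrite scale0r.
have := isomorphic_of_natural_basis BB B0; set W := (\matrix_(_, _) _) => AW.
have sqE (j : 'I_3) : sq B`_j = W i0 j *: a + W i1 j *: b + W i2 j *: v.
  rewrite /sq [LHS](coord_basis BB (memvf _)) sum3E.
  by rewrite /W !mxE.
have sa : sq a = W i0 i0 *: a + W i1 i0 *: b + W i2 i0 *: v := sqE i0.
have sv : sq v = W i0 i2 *: a + W i1 i2 *: b + W i2 i2 *: v := sqE i2.
have fB := basis_free BB.
have W1 k : W k i1 = mu * W k i0.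
  by rewrite !mxE -[mul B`_i1 _]/(sq b) bmu linearZ.
have fab p q : p *: a + q *: b = 0 -> p = 0 /\ q = 0.
  have /freeP/(_ (fun i => if i == i0 then p else if i == i1 then q else 0)) := fB.
  rewrite sum3E /= scale0r addr0 => e /e{}e; by have := e i0; have := e i1.
have pv : comp_proj E 0 v = 0 by apply: (comp_proj_eq0 EA _ vE).
have pa : comp_proj E 1 a = 0 by apply: (comp_proj_eq0 EA _ aE).
have pb : comp_proj E 1 b = 0 by apply: (comp_proj_eq0 EA _ bE).
pose z := W i0 i0 *: a + W i1 i0 *: b.
have pz : comp_proj E 0 (sq a) = z.
  by rewrite sa !linearD !linearZ /= pv scaler0 addr0 !comp_proj_id.
have sqN p q : comp_proj E 0 (sq (p *: a + q *: b)) = (p ^+ 2 + mu * q ^+ 2) *: z.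
  rewrite -pz -linearZ /= /sq; congr (comp_proj E 0 _).
  rewrite !(linearDl, linearDr) /= !(linearZl_LR, linearZr_LR) /= ab ba.
  rewrite !scaler0 addr0 add0r -[mul b b]/(sq b) bmu !scalerA -scalerDl.
  by congr (_ *: _); ring.
have pvz : comp_proj E 1 (sq v) = W i2 i2 *: v.
  by rewrite sv !linearD !linearZ /= pa pb !scaler0 !add0r comp_proj_id.
exists W, mu; split=> //.
  move=> p q pq; apply: (@free_squares _ _ _ _ EA 0 1 (sq a) (sq v) isT _ mv).
    by rewrite Ea.
  rewrite sa sv !scalerDr !scalerA addrACA -scalerDl.
  rewrite [_ *: a + _ + _]addrACA -!scalerDl !pq !scale0r !addr0 //.
have abE x : x \in E 0 -> exists p q, x = p *: a + q *: b.
  rewrite -(span_basis sB) (span_cat [:: a] [:: b]) !span_seq1.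
  by case/memv_addP => _ /vlineP[p ->] [_ /vlineP[q ->] ->]; exists p, q.
split=> /=.
- by move/(_ _ aE); rewrite pz; apply: fab.
- case/(_ isT) => x /abE[p [q ->]]; rewrite sqN.
  rewrite /z scalerDr !scalerA sqN => /eqP nz.
  apply: contra_not_neq nz => N0; rewrite !exprMn.
  have -> : forall n, n ^+ 2 * W i0 i0 ^+ 2 + mu * (n ^+ 2 * W i1 i0 ^+ 2) =
    n ^+ 2 * (W i0 i0 ^+ 2 + mu * W i1 i0 ^+ 2) by move=> n; ring.
  by rewrite N0 mulr0 scale0r.
- case/(_ isT) => -[x /abE[p [q ->]] + s00]; rewrite sqN => z0.
  have {}z0 : z != 0 by apply: contraNneq z0 => ->; rewrite scaler0.
  split.
    by have /eqP := s00 _ aE; rewrite pz sqN scaler_eq0 (negPf z0) orbF => /eqP.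
  by rewrite -negb_and; apply: contraNN z0 => /andP[/eqP e /eqP e'];
     rewrite /z e e' !scale0r addr0.
- by move/(_ _ vE)/eqP; rewrite pvz scaler_eq0 (negPf v0) orbF => /eqP.
case/(_ isT) => x; rewrite Ev => /vlineP[p ->]; apply: contraNneq => W0.
have -> : comp_proj E 1 (sq (p *: v)) = 0.
  by rewrite /sq linearZl_LR linearZr_LR !linearZ /= pvz W0 scale0r !scaler0.
by rewrite /sq linear0 linear0.
Qed.

(** * Admissible parameters *)

(** Separates delta-index (3) from the others; unlike a decomposition, it is carried along an
    isomorphism at once. *)
Definition square_in_line (F : fieldType) (A : naAlgebra F) :=
  exists z : A, forall x y, mul x y \in <[z]>%VS.

Section DeltaIndex.
Variable F : fieldType.

Lemma square_in_line_iso (A B : naAlgebra F) :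
  isomorphic A B -> square_in_line B -> square_in_line A.
Proof.
move=> [f [[g fK gK] fM]] [z zB]; exists (g z) => x y.
have /vlineP[k e] := zB (f x) (f y); apply/vlineP; exists k.
by apply: (can_inj fK); rewrite fM e linearZ /= gK.
Qed.

Lemma delta_square_in_line (A : naAlgebra F) m n d :
  delta_index A [:: m, n & d] -> ~ square_in_line A.
Proof.
move=> [_ [E [[_ _ _ _ /(_ 0 1 isT)[_ d2]] _]]] [z zA].
have sz j : (mul_space (E j) (E j) <= <[z]>)%VS.
  by apply/mul_spaceP => x y _ _; apply: zA.
have : (mul_space (E 0%R) (E 0%R) + mul_space (E 1%R) (E 1%R) <= <[z]>)%VS.
  by rewrite subv_add !sz.
by move/dimvS; rewrite d2 dim_vline; case: (_ == _).
Qed.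

Variable W : 'M[F]_3.

(** A nontrivial relation makes all columns multiples of one: of column 0 if b != 0, and of column 2
    if b = 0, since column 0 then vanishes. *)
Lemma indep_col_of_square : (forall k, W k i1 = W k i0) ->
  ~ square_in_line (evo_alg W) -> indep_col W i0 i2.
Proof.
move=> W01 Wsq a b ab.
have sq_line (z : 'cV[F]_3) c : (forall k j, W k j = c j * z k 0) ->
    square_in_line (evo_alg W).
  move=> Wz; exists z => x y; apply/vlineP.
  exists (\sum_j c j * ((x : 'cV_3) j 0 * (y : 'cV_3) j 0)).
  apply/colP=> k; rewrite /= evo_mulE mxE mulr_suml.
  by apply: eq_bigr => j _; rewrite Wz; ring.
have [b0|b0] := eqVneq b 0; last first.
  case: Wsq; apply: (sq_line (col i0 W) (fun j => if j == i2 then - (a / b) else 1)).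
  move=> k; apply: ord3_ind; rewrite mxE /= ?mul1r ?W01 //.
  by apply: (mulfI b0); rewrite mulrA mulrN mulrCA divff // mulr1 mulNr;
     apply/eqP; rewrite -addr_eq0 addrC ab.
split=> //; apply/eqP/negPn/negP => a0; case: Wsq.
have W0 k : W k i0 = 0.
  by apply: (mulfI a0); have := ab k; rewrite b0 mul0r addr0 mulr0.
apply: (sq_line (col i2 W) (fun j => (j == i2)%:R)).
by move=> k; apply: ord3_ind; rewrite !mxE /= ?mul0r ?mul1r ?W01.
Qed.

Lemma indep_col_neq0 i j : indep_col W i j ->
  (exists k, W k i != 0) /\ (exists k, W k j != 0).
Proof.
move=> Wij; split; apply/existsP; apply: contraT; rewrite negb_exists => /forallP W0.
  have [|/eqP] := Wij 1 0; last by rewrite oner_eq0.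
  by move=> k; move: (W0 k); rewrite negbK => /eqP->; rewrite mulr0 mul0r addr0.
have [|_ /eqP] := Wij 0 1; last by rewrite oner_eq0.
by move=> k; move: (W0 k); rewrite negbK => /eqP->; rewrite mulr0 mul0r addr0.
Qed.

Lemma indep_col_free i j (V : 'M[F]_3) : indep_col W i j ->
  free [:: (col i W : evo_alg V); col j W].
Proof.
move=> Wij; apply/(@freeP _ _ 2 [tuple _; _]) => k; rewrite !big_ord_recl big_ord0 addr0 /=.
move=> e; have [|k0 k1] := Wij (k ord0) (k (lift ord0 ord0)).
  by move=> l; move/colP/(_ l): e; rewrite !mxE.
by case=> [[|[|//]] p]; [rewrite -[RHS]k0 | rewrite -[RHS]k1]; congr (k _); apply: val_inj.
Qed.

Lemma col_neq0 j : (exists k, W k j != 0) -> col j W != 0.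
Proof. by move=> [k]; apply: contraNneq => /colP/(_ k); rewrite !mxE => ->. Qed.

Lemma delta111 : indep_cols W ->
  non_degenerate (evo_alg W) /\ delta_index (evo_alg W) [:: 1; 1; 1]%N.
Proof.
move=> Wi; have W0 : forall j, exists k, W k j != 0.
  by apply: ord3_ind; [have [] := indep_col_neq0 (Wi i0 i1 isT)
    | have [] := indep_col_neq0 (Wi i1 i0 isT)
    | have [] := indep_col_neq0 (Wi i2 i0 isT)].
split; first exact: evo_non_degenerate.
split=> //; exists (coord_block W id); split.
  apply: (evolution_decomposition_blocks (zeta := fun j => col j W) (mu := fun=> 1)).
  - by move=> j; exists j.
  - by move=> _; apply: oner_neq0.
  - by move=> j; rewrite scale1r.
  - by move=> j k jk; apply/indep_col_free/Wi.
  - by move=> j; apply/col_neq0.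
by apply: ord3_ind; rewrite dim_coord_block /= card1.
Qed.

Lemma delta21 : (forall k, W k i1 = W k i0) -> indep_col W i0 i2 ->
  non_degenerate (evo_alg W) /\ delta_index (evo_alg W) [:: 2; 1]%N.
Proof.
move=> W01 Wi; have [W0 W2] := indep_col_neq0 Wi.
have W_0 : forall j, exists k, W k j != 0.
  apply: ord3_ind => //; by have [k Wk] := W0; exists k; rewrite W01.
split; first exact: evo_non_degenerate.
split=> //; pose h (i : 'I_3) : 'I_2 := if i == i2 then 1 else 0.
exists (coord_block W h); split.
  apply: (evolution_decomposition_blocks
    (zeta := fun j => if j == 0 then col i0 W else col i2 W) (mu := fun=> 1)).
  - case=> [[|[|//]] p]; [exists i0 | exists i2]; exact: val_inj.
  - by move=> _; apply: oner_neq0.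
  - by apply: ord3_ind; rewrite scale1r //; apply/colP=> k; rewrite !mxE.
  - move=> [[|[|//]] p] [[|[|//]] q] //= _.
      exact: (indep_col_free W Wi).
    by apply: (indep_col_free W) => a b ba; have [|? ?] := Wi b a => // k; rewrite addrC.
  - by case=> [[|[|//]] p]; apply/col_neq0.
by case=> [[|[|//]] p]; rewrite dim_coord_block -sum1_card big_mkcond sum3E.
Qed.

Lemma delta3 : (forall k, W k i1 = W k i0) -> (forall k, W k i2 = W k i0) ->
    (exists k, W k i0 != 0) ->
  non_degenerate (evo_alg W) /\ delta_index (evo_alg W) [:: 3]%N.
Proof.
move=> W01 W02 W0; have W_0 : forall j, exists k, W k j != 0.
  apply: ord3_ind => //; have [k Wk] := W0; exists k; by rewrite ?W01 ?W02.
split; first exact: evo_non_degenerate.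
split=> //; pose h (i : 'I_3) : 'I_1 := 0.
exists (coord_block W h); split.
  apply: (evolution_decomposition_blocks
    (zeta := fun=> col i0 W) (mu := fun=> 1)).
  - by move=> j; exists i0; rewrite [RHS]ord1.
  - by move=> _; apply: oner_neq0.
  - by apply: ord3_ind; rewrite scale1r //; apply/colP=> k; rewrite !mxE.
  - by move=> j k; rewrite [j]ord1 [k]ord1.
  - by move=> _; apply/col_neq0.
by move=> j; rewrite [j]ord1 dim_coord_block -sum1_card big_mkcond sum3E.
Qed.

(** The decomposition may come from another natural basis: independence is found for an isomorphic
    [V] and carried back to [W]. *)
Lemma indep_cols_of_delta111 :
  delta_index (evo_alg W) [:: 1; 1; 1]%N -> indep_cols W.
Proof.
move=> [_ [E [EW d1]]].
have [|V [WV Vi _]] := decomposition_lines EW.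
  by apply: ord3_ind; rewrite d1.
exact: (indep_cols_iso Vi WV).
Qed.

End DeltaIndex.

Section Admissible.
Variables (F : fieldType) (imag : F).

Lemma admissible_indep_cols (x : listed F) : admissible imag x ->
  listed_delta x = [:: 1; 1; 1]%N -> indep_cols (listed_mx imag x).
Proof. by case=> _ + _ => /[swap] -> /indep_cols_of_delta111. Qed.

Lemma listed_mx01 (x : listed F) : listed_delta x <> [:: 1; 1; 1]%N ->
  forall k, listed_mx imag x k i1 = listed_mx imag x k i0.
Proof. by move=> x21 k; case: x x21 => //= *; move: k; apply: ord3_ind; rewrite !mxE. Qed.

Lemma admissible_indep_col (x : listed F) : admissible imag x ->
  listed_delta x = [:: 2; 1]%N -> indep_col (listed_mx imag x) i0 i2.
Proof.
case=> _ dx _ x21; apply: indep_col_of_square.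
  by apply: listed_mx01; rewrite x21.
by rewrite x21 in dx; apply: (delta_square_in_line dx).
Qed.

Lemma admissible111 (x : listed F) : listed_delta x = [:: 1; 1; 1]%N ->
  indep_cols (listed_mx imag x) -> admissible imag x.
Proof. by move=> dx /delta111[nd d]; split; rewrite ?dx //; case: x dx {nd d}. Qed.

Lemma admissible21 (x : listed F) : listed_delta x = [:: 2; 1]%N ->
  match x with B313 a => a != 0 | _ => True end ->
  indep_col (listed_mx imag x) i0 i2 -> admissible imag x.
Proof.
move=> dx x0 xi; have [|nd d] := delta21 _ xi; first by apply: listed_mx01; rewrite dx.
by split; rewrite ?dx.
Qed.

Lemma admissible3 (x : listed F) : listed_delta x = [:: 3]%N -> admissible imag x.
Proof.
move=> dx.
have [|||nd d] := @delta3 _ (listed_mx imag x); last first.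
- by split; rewrite ?dx //; case: x dx {nd d}.
- by exists i0; case: x dx => //= _; rewrite mxE /= oner_neq0.
- by case: x dx => //= _; apply: ord3_ind; rewrite !mxE.
- by apply: listed_mx01; rewrite dx.
Qed.

Lemma delta_of_listed (x : listed F) : [\/ listed_delta x = [:: 1; 1; 1]%N,
  listed_delta x = [:: 2; 1]%N | listed_delta x = [:: 3]%N].
Proof. by case: x => *; by [apply: Or31 | apply: Or32 | apply: Or33]. Qed.

End Admissible.

(** * Invariants in type (2, 1) *)

Lemma unitmx_ker3 (F : fieldType) (M : 'M[F]_3) a b c : M \in unitmx ->
  (forall k, M k i0 * a + M k i1 * b + M k i2 * c = 0) ->
  [/\ a = 0, b = 0 & c = 0].
Proof.
move=> Mu Mv; pose v : 'cV_3 := \col_k [:: a; b; c]`_k.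
have : v = 0.
  rewrite -[v](mulKmx Mu); suff -> : M *m v = 0 by rewrite mulmx0.
  by apply/colP=> k; rewrite mxE sum3E !mxE Mv.
by move=> /colP v0; have := v0 i0; have := v0 i1; have := v0 i2; rewrite !mxE.
Qed.

Section PlanarInvariants.
Variable F : fieldType.
Implicit Types V W : 'M[F]_3.

(* For the algebra with e_0^2 = e_1^2 = z and e_2^2 = w, these are the entries of
   the Gram matrix of the projections of z and w to the plane of e_0 and e_1. *)
Definition zz W := W i0 i0 ^+ 2 + W i1 i0 ^+ 2.
Definition zw W := W i0 i0 * W i0 i2 + W i1 i0 * W i1 i2.
Definition ww W := W i0 i2 ^+ 2 + W i1 i2 ^+ 2.

(* An isomorphism is a similitude of the plane with ratio l on e_0 and e_1, and
   multiplies e_2 by c. *)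
Variant planar_rel V W : Prop := PlanarRel (l c : F) of
  l != 0 & c != 0 &
  zz V = l * zz W & zw V = c ^+ 2 * zw W & l * ww V = c ^+ 4 * ww W &
  c * V i2 i0 = l * W i2 i0 & V i2 i2 = c * W i2 i2 &
  (W i0 i0 = 0 -> W i1 i0 = 0 -> V i0 i0 = 0 /\ V i1 i0 = 0) &
  (forall a, W i0 i2 = a * W i0 i0 -> W i1 i2 = a * W i1 i0 ->
    l * V i0 i2 = c ^+ 2 * a * V i0 i0 /\ l * V i1 i2 = c ^+ 2 * a * V i1 i0) &
  (W i0 i2 = 0 -> W i1 i2 = 0 -> V i0 i2 = 0 /\ V i1 i2 = 0).

(** Since columns 0 and 2 of [W] are independent, their coefficients in the product of two images
    can be compared separately. This forces the matrix into a planar similitude and a scalar on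
    e_2. *)
Lemma planar_iso V W :
    (forall k, V k i1 = V k i0) -> (forall k, W k i1 = W k i0) ->
    indep_col W i0 i2 ->
  isomorphic (evo_alg V) (evo_alg W) -> planar_rel V W.
Proof.
move=> V01 W01 Wi [f fi]; have Mu := hom_mx_unit fi.1.
have := hom_mx_mul fi; set M := hom_mx f in Mu * => e.
have {}e i j l : (i == j)%:R * (M l i0 * V i0 i + M l i1 * V i1 i + M l i2 * V i2 i)
    = (M i0 i * M i0 j + M i1 i * M i1 j) * W l i0 + (M i2 i * M i2 j) * W l i2.
  by have := e i j l; rewrite !sum3E W01 => ->; ring.
have M0 i j : i != j -> M i0 i * M i0 j + M i1 i * M i1 j = 0 /\ M i2 i * M i2 j = 0.
  by move=> ij; apply: Wi => l; rewrite -e (negPf ij) mul0r.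
(* Columns 0 and 1 of [V] agree, so the images of e_0 and e_1 have the same square. *)
have [N01 M01] : M i0 i0 * M i0 i0 + M i1 i0 * M i1 i0 -
     (M i0 i1 * M i0 i1 + M i1 i1 * M i1 i1) = 0 /\
    M i2 i0 * M i2 i0 - M i2 i1 * M i2 i1 = 0.
  apply: Wi => l; have := e i1 i1 l; have := e i0 i0 l; rewrite !eqxx !V01 => -> e0.
  by rewrite !mulrBl addrACA -opprD -e0 subrr.
(* These two coordinates have product 0 and equal squares. *)
have [M20 M21] : M i2 i0 = 0 /\ M i2 i1 = 0.
  have /eqP := (M0 i0 i1 isT).2; rewrite mulf_eq0 => /orP[]/eqP M2; split=> //.
    by move/eqP: M01; rewrite M2 mulr0 sub0r oppr_eq0 mulf_eq0 orbb => /eqP.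
  by move/eqP: M01; rewrite M2 mulr0 subr0 mulf_eq0 orbb => /eqP.
set a := M i0 i0 in e M0 N01; set b := M i1 i0 in e M0 N01.
set p := M i0 i1 in e M0 N01; set q := M i1 i1 in e M0 N01.
have det0 : a * q - b * p != 0.
  apply/eqP => d0.
  have [|q0 b0 _] := @unitmx_ker3 _ M q (- b) 0 Mu.
    apply: ord3_ind; rewrite -/a -/b -/p -/q ?M20 ?M21; try ring.
    by rewrite -[RHS]d0; ring.
  have [|_ a0 _] := @unitmx_ker3 _ M p (- a) 0 Mu.
    apply: ord3_ind; rewrite -/a -/b -/p -/q ?M20 ?M21; try ring.
    by rewrite -[RHS]oppr0 -[X in _ = - X]d0; ring.
  have [|/eqP] := @unitmx_ker3 _ M 1 0 0 Mu; last by rewrite oner_eq0.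
  move/eqP: b0; move/eqP: a0; rewrite !oppr_eq0 => /eqP a0 /eqP b0.
  by apply: ord3_ind; rewrite -/a -/b ?M20 ?a0 ?b0; ring.
have solve0 x y : a * x + p * y = 0 -> b * x + q * y = 0 -> x = 0 /\ y = 0.
  move=> u0 v0; split; apply: (mulfI det0); rewrite mulr0.
    transitivity (q * (a * x + p * y) - p * (b * x + q * y)); first by ring.
    by rewrite u0 v0; ring.
  transitivity (a * (b * x + q * y) - b * (a * x + p * y)); first by ring.
  by rewrite u0 v0; ring.
have apbq := (M0 i0 i1 isT).1; rewrite -/a -/b -/p -/q in apbq.
pose L := a * a + b * b; have pqL : p * p + q * q = L.
  by apply/eqP; rewrite eq_sym -subr_eq0 N01.
(* Lagrange's identity: L (p^2 + q^2) = (a p + b q)^2 + (a q - b p)^2. *)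
have L0 : L != 0.
  apply: contra_neq det0 => L0; apply/eqP; rewrite -sqrf_eq0; apply/eqP.
  transitivity (L * (p * p + q * q) - (a * p + b * q) ^+ 2); first by rewrite /L; ring.
  by rewrite L0 apbq; ring.
have [M02 M12] : M i0 i2 = 0 /\ M i1 i2 = 0.
  have := (M0 i0 i2 isT).1; have := (M0 i1 i2 isT).1; rewrite -/a -/b -/p -/q => v0 u0.
  split; apply: (mulfI det0); rewrite mulr0.
    transitivity (q * (a * M i0 i2 + b * M i1 i2) - b * (p * M i0 i2 + q * M i1 i2)).
      by ring.
    by rewrite u0 v0; ring.
  transitivity (a * (p * M i0 i2 + q * M i1 i2) - p * (a * M i0 i2 + b * M i1 i2)).
    by ring.
  by rewrite u0 v0; ring.
set c := M i2 i2 in e M0.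
have c0 : c != 0.
  apply/eqP=> c0; have [|_ _ /eqP] := @unitmx_ker3 _ M 0 0 1 Mu.
    by apply: ord3_ind; rewrite ?M02 ?M12 -/c ?c0; ring.
  by rewrite oner_eq0.
have := e i0 i0 i0; have := e i0 i0 i1; have := e i0 i0 i2.
have := e i2 i2 i0; have := e i2 i2 i1; have := e i2 i2 i2.
rewrite !eqxx -/a -/b -/c -/p -/q M20 M21 M02 M12 -/L !(mul0r, mulr0, addr0, add0r, mul1r).
move=> w1E w2E w0E z1E z2E z0E.
(* The planar block has orthogonal columns of the same norm [L], so it multiplies the bilinear form
   by [L]. *)
have bil x y u v : (a * x + p * y) * (a * u + p * v) + (b * x + q * y) * (b * u + q * v)
   = L * (x * u + y * v).
  transitivity (L * (x * u) + (p * p + q * q) * (y * v) +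
    (a * p + b * q) * (x * v + y * u)); first by rewrite /L; ring.
  by rewrite pqL apbq; ring.
apply: (@PlanarRel _ _ L c) => //.
- by apply: (mulfI L0); rewrite /zz !expr2 -(bil (V i0 i0) (V i1 i0)) z0E z2E; ring.
- by apply: (mulfI L0); rewrite /zw -(bil (V i0 i0) (V i1 i0)) z0E z2E w0E w2E; ring.
- by rewrite /ww !expr2 -(bil (V i0 i2) (V i1 i2)) w0E w2E; ring.
- by apply: (mulfI c0); rewrite w1E; ring.
- by move=> W0 W1; apply: solve0; rewrite ?z0E ?z2E ?W0 ?W1 mulr0.
- move=> al W0 W1.
  have [||/eqP + /eqP] := solve0 (L * V i0 i2 - c ^+ 2 * al * V i0 i0)
                                (L * V i1 i2 - c ^+ 2 * al * V i1 i0).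
  + transitivity (L * (a * V i0 i2 + p * V i1 i2) -
      c ^+ 2 * al * (a * V i0 i0 + p * V i1 i0)); first by ring.
    by rewrite z0E w0E W0; ring.
  + transitivity (L * (b * V i0 i2 + q * V i1 i2) -
      c ^+ 2 * al * (b * V i0 i0 + q * V i1 i0)); first by ring.
    by rewrite z2E w2E W1; ring.
  by rewrite !subr_eq0 => /eqP-> /eqP->.
by move=> W0 W1; apply: solve0; rewrite ?w0E ?w2E ?W0 ?W1 mulr0.
Qed.

(** A decision tree on conditions whose truth is unchanged when [planar_rel] holds both ways. Its
    value on an admissible listed matrix is the second index of the family. *)
Definition planar_code W : nat :=
  if (W i0 i0 == 0) && (W i1 i0 == 0) then
    if W i2 i2 == 0 then (if ww W == 0 then 2 else 1)
    else (if ww W == 0 then 4 else 3)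
  else if zz W != 0 then
    if W i2 i2 == 0 then (if W i2 i0 == 0 then 6 else 5) else 7
  else if W i2 i2 == 0 then
    if W i2 i0 == 0 then (if ww W == 0 then 11 else 10)
    else (if ww W == 0 then 9 else 8)
  else if W i2 i0 != 0 then 12
  else if ww W != 0 then 13
  else if (zw W == 0) && ((W i0 i2 != 0) || (W i1 i2 != 0)) then 14 else 15.

(** Translates each Delta-trace of case (II) into a range of family numbers. *)
Lemma planar_code_cases W (b : bool) : (W i2 i2 == 0) = b ->
  [/\ W i0 i0 = 0 -> W i1 i0 = 0 ->
        planar_code W \in (if b then [:: 1; 2] else [:: 3; 4])%N,
      zz W != 0 -> planar_code W \in (if b then [:: 5; 6] else [:: 7])%N &
      zz W = 0 -> (W i0 i0 != 0) || (W i1 i0 != 0) -> planar_code W \in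
        (if b then [:: 8; 9; 10; 11] else [:: 12; 13; 14; 15])%N].
Proof.
rewrite /planar_code => ->; split.
- by move=> -> ->; rewrite eqxx /=; do !case: ifP.
- move=> N0; have -> : (W i0 i0 == 0) && (W i1 i0 == 0) = false.
    apply: contraNF N0 => /andP[/eqP e0 /eqP e1].
    by rewrite /zz e0 e1 expr0n addr0.
  by rewrite N0; do !case: ifP.
by move=> N0; rewrite -negb_and => /negPf->; rewrite N0 eqxx /=; do !case: ifP.
Qed.

(** The scalar relations can be reversed since l and c are nonzero; the clauses on vanishing vectors
    are mere implications, so [planar_rel] is needed in both directions. *)
Lemma planar_code_rel V W : planar_rel V W -> planar_rel W V ->
  planar_code V = planar_code W.
Proof.
case=> l c l0 c0 zzV zwV wwV z1 w1 z0 _ w0 [l' c' l0' c0' _ _ _ _ _ z0' _ w0'].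
have {z0 z0'} e1 : (V i0 i0 == 0) && (V i1 i0 == 0) = (W i0 i0 == 0) && (W i1 i0 == 0).
  by apply/andP/andP => -[/eqP x0 /eqP y0];
    [have [-> ->] := z0' x0 y0 | have [-> ->] := z0 x0 y0].
have {w0 w0'} e2 : (V i0 i2 == 0) && (V i1 i2 == 0) = (W i0 i2 == 0) && (W i1 i2 == 0).
  by apply/andP/andP => -[/eqP x0 /eqP y0];
    [have [-> ->] := w0' x0 y0 | have [-> ->] := w0 x0 y0].
have e3 : (zz V == 0) = (zz W == 0) by rewrite zzV mulf_eq0 (negPf l0).
have e4 : (zw V == 0) = (zw W == 0) by rewrite zwV mulf_eq0 expf_eq0 (negPf c0).
have e5 : (ww V == 0) = (ww W == 0).
  have -> : (ww W == 0) = (c ^+ 4 * ww W == 0) by rewrite mulf_eq0 expf_eq0 (negPf c0).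
  by rewrite -wwV mulf_eq0 (negPf l0).
have e6 : (V i2 i0 == 0) = (W i2 i0 == 0).
  have -> : (W i2 i0 == 0) = (l * W i2 i0 == 0) by rewrite mulf_eq0 (negPf l0).
  by rewrite -z1 mulf_eq0 (negPf c0).
have e7 : (V i2 i2 == 0) = (W i2 i2 == 0) by rewrite w1 mulf_eq0 (negPf c0).
by rewrite /planar_code -!negb_and e1 e2 e3 e4 e5 e6 e7.
Qed.
End PlanarInvariants.

Definition planar_num (F : Type) (x : listed F) : nat :=
  match x with
  | B31 => 1 | B32 => 2 | B33 _ => 3 | B34 => 4 | B35 _ _ => 5 | B36 _ => 6
  | B37 _ _ _ => 7 | B38 _ => 8 | B39 _ => 9 | B310 => 10 | B311 => 11
  | B312 _ _ => 12 | B313 _ => 13 | B314 => 14 | B315 _ => 15 | _ => 0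
  end.

(** * Invariants of the listed algebras of type (2, 1) *)

Section PlanarListed.
Variables (F : closedFieldType) (imag : F).
Hypotheses (imag2 : imag ^+ 2 = -1) (two0 : 2 != 0 :> F).

Lemma imag_neq0 : imag != 0.
Proof.
by apply/eqP=> i0; move/eqP: imag2; rewrite i0 expr0n /= eq_sym oppr_eq0 oner_eq0.
Qed.

Lemma planar_code_listed (x : listed F) : listed_delta x = [:: 2; 1]%N ->
  match x with B313 a => a != 0 | _ => True end ->
  indep_col (listed_mx imag x) i0 i2 ->
  planar_code (listed_mx imag x) = planar_num x.
Proof.
have i0n := imag_neq0.
case: x => //= [||a||a b|a|a b c|a|s|||a b|a||a] _ x0 xi;
  rewrite /planar_code /zz /zw /ww !mxE /=; 
  rewrite ?(negPf i0n) ?expr0n ?expr1n ?exprMn ?sqrrN ?imag2 ?(mul0r, mulr0, mul1r, mulr1);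
  rewrite ?(add0r, addr0) ?subrr ?eqxx ?oner_eq0 //=.
(* [B38] with parameter 0 has a zero column, against independence. *)
- case: ifP => //; rewrite sqrf_eq0 => /eqP a0.
  have [|_ /eqP] := xi 0 1; last by rewrite oner_eq0.
  by apply: ord3_ind; rewrite !mxE /= ?a0; ring.
- by case: s {x0 xi} => /=; rewrite ?sqrrN imag2 subrr eqxx.
- by rewrite sqrf_eq0 x0.
- by rewrite -expr2 imag2 subrr eqxx.
(* For [B315], zw = 2 a, and the projection of w vanishes exactly when a does: the test for 14
   always fails. *)
have -> : a + imag * (- a * imag) = 2 * a.
  by transitivity (a - imag ^+ 2 * a); [ring | rewrite imag2; ring].
rewrite mulrN1 subrr eqxx mulf_eq0 (negPf two0) /=.
by have [->|] := eqVneq a 0; rewrite ?oppr0 ?mul0r ?eqxx.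
Qed.

Ltac simplify_planar := rewrite /zz /zw /ww !mxE /=;
  rewrite ?expr0n ?expr1n ?exprMn ?sqrrN ?imag2 ?(mul0r, mulr0, mul1r, mulr1);
  rewrite ?(add0r, addr0) ?subrr ?mulr1.

Lemma planar_identified (x y : listed F) : listed_delta x = [:: 2; 1]%N ->
    match y with B313 a => a != 0 | _ => True end ->
    indep_col (listed_mx imag y) i0 i2 ->
    same_family x y -> planar_rel (listed_mx imag x) (listed_mx imag y) ->
  identified x y.
Proof.
move=> dx y0 yi xy [l c l0 c0 + + + + + _ + _].
case: x dx xy => //= [||a||a b|a|a1 a2 a3|a|s|||a b|a||a] _; case: y y0 yi => //=.
- move=> a' _ yi _; simplify_planar.
  by move=> _ _ wwE z1E c1 _; move: wwE z1E; rewrite -c1 expr1n => ->; rewrite !mul1r => ->.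
- move=> a' b' _ yi _; simplify_planar.
  move=> <- zwE wwE z1E _ _; move: zwE wwE; rewrite z1E !expr1n !mul1r => ->.
  by move/addrI/esym/eqP; rewrite eqf_sqr => /orP[]/eqP->; split; auto.
- move=> a' _ yi _; simplify_planar.
  move=> <- zwE; rewrite mul1r zwE => wwE _ _ _.
  (* Hence c^2 is 1 or -1, which is the sign in a = c^2 a'. *)
  have /eqP : c ^+ 4 = 1.
    apply: (addrI (c ^+ 4 * a' ^+ 2)); transitivity (c ^+ 4 * (a' ^+ 2 + 1)).
      by ring.
    by rewrite -wwE; ring.
  rewrite -[4%N]/(2 * 2)%N exprM -subr_eq0 subr_sqr_1 mulf_eq0 subr_eq0 addr_eq0.
  by case/orP => /eqP->; [left; ring | right; ring].
- move=> a1' a2' a3' _ yi _; simplify_planar.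
  move=> <- zwE wwE z1E c1 _; move: zwE wwE z1E; rewrite -c1 !expr1n !mul1r => -> + ->.
  by move/addrI/esym/eqP; rewrite eqf_sqr => /orP[]/eqP->; split; auto.
- move=> a' _ yi _; simplify_planar.
  move=> _ zwE wwE z1E _ _.
  have a'0 : a' != 0.
    apply/eqP=> a0; have [|_ /eqP] := yi 0 1; last by rewrite oner_eq0.
    by apply: ord3_ind; rewrite !mxE /= ?a0; ring.
  suff c1 : c = 1 by rewrite zwE c1; congr (B38 _); ring.
  (* With l = c and a = c^2 a', the relation for ww reads c^5 a'^2 = c^4 a'^2. *)
  apply: (mulfI (_ : c ^+ 4 * a' ^+ 2 != 0)); first by rewrite mulf_neq0 ?expf_neq0.
  by rewrite mulr1 -[RHS]wwE -z1E zwE; ring.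
- move=> s' _ yi _; simplify_planar.
  have JJ : imag * imag = -1 by rewrite -expr2.
  (* The two signs differ in zw, which is 0 for + and 2 for -. *)
  case: s s' {yi} => [] [] //= _; rewrite ?mulrN JJ opprK subrr ?mulr0 => + _ _ _ _.
    move/esym/eqP; rewrite mulf_eq0 expf_eq0 (negPf c0) /=.
    by rewrite -mulr2n (negPf two0).
  by move/eqP; rewrite -mulr2n (negPf two0).
- move=> a' b' _ yi _; simplify_planar.
  move=> _ zwE wwE z1E c1 wE; move: zwE wwE wE; rewrite -z1E -c1 !expr1n !mul1r.
  move=> zwE wwE wE.
  (* If zw vanishes, the Gram matrix does not determine a and b. But then the projection of w is a'
     times that of z, and the proportionality clause of [planar_rel] applies. Otherwise the factor a
     + i b of ww can be cancelled. *)
  have [e0|e0] := eqVneq (a' + imag * b') 0.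
    have b'E : b' = a' * imag.
      have : imag * (a' + imag * b') = 0 by rewrite e0 mulr0.
      rewrite mulrDr mulrA -expr2 imag2 mulN1r => /eqP; rewrite subr_eq0 => /eqP <-.
      by ring.
    have [||-> ->] := wE a'; rewrite ?mulr1 ?mul1r //.
    by rewrite b'E.
  have e1 : a - imag * b = a' - imag * b'.
    apply: (mulfI e0); rewrite -{1}zwE.
    have sum_sq (u v : F) : (u + imag * v) * (u - imag * v) = u ^+ 2 + v ^+ 2.
      by transitivity (u ^+ 2 - imag ^+ 2 * v ^+ 2); [ring | rewrite imag2; ring].
    by rewrite !sum_sq.
  have ea : a = a'.
    apply: (mulfI two0); transitivity ((a + imag * b) + (a - imag * b)); first by ring.
    by rewrite zwE e1; ring.
  by rewrite ea; congr (B312 _ _); apply: (mulfI imag_neq0); move: zwE; rewrite ea => /addrI.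
- move=> a' a'0 yi _; simplify_planar.
  by move=> _ zwE _ _ c1 _; rewrite zwE -c1 expr1n mul1r.
- move=> a' _ yi _; simplify_planar.
  move=> _ zwE _ _ c1 _; congr (B315 _); move: zwE; rewrite -c1 expr1n mul1r.
  have e (u : F) : u + imag * (- u * imag) = 2 * u.
    by transitivity (u - imag ^+ 2 * u); [ring | rewrite imag2; ring].
  by rewrite !e => /(mulfI two0).
Qed.

End PlanarListed.

(** * Normal forms in type (2, 1) *)

Lemma closed_root (F : closedFieldType) n (a : F) : (0 < n)%N -> exists x, x ^+ n = a.
Proof.
move=> n0; have [x xE] := @solve_monicpoly F n (fun i => if i == 0%N then a else 0) n0.
exists x; rewrite xE -(prednK n0) big_ord_recl /= expr0 mulr1 big1 ?addr0 // => i _.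
by rewrite mul0r.
Qed.

Lemma closed_root_neq0 (F : closedFieldType) n (a : F) : (0 < n)%N -> a != 0 ->
  exists2 x, x ^+ n = a & x != 0.
Proof.
move=> n0 a0; have [x xa] := closed_root a n0; exists x => //.
by apply: contraNneq a0 => x0; rewrite -xa x0 expr0n eqn0Ngt n0.
Qed.

(** The map with planar block (a, -b; b, a), a similitude of ratio a^2 + b^2, and factor c on e_2;
    the six equations compare the images of e_0^2 and e_2^2. *)
Lemma isomorphic_rotation (F : fieldType) (V W : 'M[F]_3) a b c :
  a ^+ 2 + b ^+ 2 != 0 -> c != 0 ->
  (forall k, V k i1 = V k i0) -> (forall k, W k i1 = W k i0) ->
  a * V i0 i0 - b * V i1 i0 = (a ^+ 2 + b ^+ 2) * W i0 i0 ->
  b * V i0 i0 + a * V i1 i0 = (a ^+ 2 + b ^+ 2) * W i1 i0 ->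
  c * V i2 i0 = (a ^+ 2 + b ^+ 2) * W i2 i0 ->
  a * V i0 i2 - b * V i1 i2 = c ^+ 2 * W i0 i2 ->
  b * V i0 i2 + a * V i1 i2 = c ^+ 2 * W i1 i2 ->
  V i2 i2 = c * W i2 i2 ->
  isomorphic (evo_alg V) (evo_alg W).
Proof.
set L := _ + _ => L0 c0 V01 W01 e0 e1 e2 f0 f1 f2.
pose M := mx_of_rows [:: [:: a; - b; 0]; [:: b; a; 0]; [:: 0; 0; c]].
pose N := mx_of_rows [:: [:: a / L; b / L; 0]; [:: - b / L; a / L; 0]; [:: 0; 0; c^-1]].
have ME (x : 'cV[F]_3) : [/\ (M *m x) i0 0 = a * x i0 0 - b * x i1 0,
    (M *m x) i1 0 = b * x i0 0 + a * x i1 0 & (M *m x) i2 0 = c * x i2 0].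
  by rewrite !mxE !sum3E !mxE /=; split; ring.
apply: (@isomorphic_of_mx _ _ _ _ M).
  suff /mulmx1_unit[] : N *m M = 1%:M by [].
  by apply/matrixP; do 2![apply: ord3_ind]; rewrite !mxE sum3E !mxE /= /L; field.

move=> x y; have [x0 x1 x2] := ME x; have [y0 y1 y2] := ME y.
have [v0 v1 v2] := ME (evo_mul V x y).
apply/colP; apply: ord3_ind; rewrite ?v0 ?v1 ?v2 !evo_mulE !sum3E ?V01 ?W01 x0 x1 x2 y0 y1 y2.
- transitivity ((a * V i0 i0 - b * V i1 i0) * (x i0 0 * y i0 0 + x i1 0 * y i1 0)
    + (a * V i0 i2 - b * V i1 i2) * (x i2 0 * y i2 0)); first by ring.
  by rewrite e0 f0 /L; ring.
- transitivity ((b * V i0 i0 + a * V i1 i0) * (x i0 0 * y i0 0 + x i1 0 * y i1 0)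
    + (b * V i0 i2 + a * V i1 i2) * (x i2 0 * y i2 0)); first by ring.
  by rewrite e1 f1 /L; ring.
transitivity ((c * V i2 i0) * (x i0 0 * y i0 0 + x i1 0 * y i1 0)
    + c * V i2 i2 * (x i2 0 * y i2 0)); first by ring.
by rewrite e2 f2 /L; ring.
Qed.

Section PlanarExistence.
Variables (F : closedFieldType) (imag : F).
Hypotheses (imag2 : imag ^+ 2 = -1) (two0 : 2 != 0 :> F).

Definition planar_listed (W : 'M[F]_3) := exists x : listed F,
  [/\ listed_delta x = [:: 2; 1]%N, match x with B313 a => a != 0 | _ => True end &
      isomorphic (evo_alg W) (listed_alg imag x)].

(* The projections of z and w to the plane are a1 f + a2 g and b1 f + b2 g for the
   isotropic vectors f = (1, i) and g = (1, -i). *)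
Definition isotropic_mx a1 a2 z1 b1 b2 w1 : 'M[F]_3 := mx_of_rows
  [:: [:: a1 + a2; a1 + a2; b1 + b2];
      [:: imag * (a1 - a2); imag * (a1 - a2); imag * (b1 - b2)];
      [:: z1; z1; w1]].

Lemma isotropic_mxP (W : 'M[F]_3) : (forall k, W k i1 = W k i0) ->
  exists a1 a2 z1 b1 b2 w1, W = isotropic_mx a1 a2 z1 b1 b2 w1.
Proof.
move=> W01.
exists ((W i0 i0 - imag * W i1 i0) / 2), ((W i0 i0 + imag * W i1 i0) / 2), (W i2 i0).
exists ((W i0 i2 - imag * W i1 i2) / 2), ((W i0 i2 + imag * W i1 i2) / 2), (W i2 i2).
have eJ (u v : F) : v = imag * ((u - imag * v) / 2 - (u + imag * v) / 2).
  by transitivity (- imag ^+ 2 * v); [rewrite imag2 opprK mul1r | field].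
apply/matrixP; do 2![apply: ord3_ind]; rewrite ?W01 !mxE //=; try exact: eJ; by field.
Qed.

Variables (a1 a2 z1 b1 b2 w1 : F).
Notation W := (isotropic_mx a1 a2 z1 b1 b2 w1).

(* The similitude of the plane multiplies f by s and g by t, so its ratio is s t. *)
Lemma realize x s t c : s != 0 -> t != 0 -> c != 0 ->
  listed_delta x = [:: 2; 1]%N -> match x with B313 a => a != 0 | _ => True end ->
  let L := listed_mx imag x in
  t * a1 + s * a2 = L i0 i0 -> imag * (t * a1 - s * a2) = L i1 i0 ->
  s * t * z1 = c * L i2 i0 ->
  c ^+ 2 * (t * b1 + s * b2) = s * t * L i0 i2 ->
  c ^+ 2 * imag * (t * b1 - s * b2) = s * t * L i1 i2 ->
  c * w1 = L i2 i2 -> planar_listed W.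
Proof.
move=> s0 t0 c0 dx x0 L e0 e1 e2 f0 f1 f2; exists x; split=> //.
(* Chosen so that A - i B = s and A + i B = t, the factors of the rotation on f and g. The map goes
   from the listed algebra to [W]. *)
apply: isomorphic_sym; pose A := (s + t) / 2; pose B := imag * (s - t) / 2.
have AB : A ^+ 2 + B ^+ 2 = s * t.
  transitivity ((s + t) ^+ 2 / 4 + imag ^+ 2 * (s - t) ^+ 2 / 4).
    by rewrite /A /B; field; rewrite -[4]/(2 * 2)%:R natrM mulf_neq0.
  by rewrite imag2; field; rewrite -[4]/(2 * 2)%:R natrM mulf_neq0.
have st0 : s * t != 0 by rewrite mulf_neq0.
have LE (u v : F) : A * (t * u + s * v) - B * (imag * (t * u - s * v)) = s * t * (u + v)
   /\ B * (t * u + s * v) + A * (imag * (t * u - s * v)) = s * t * (imag * (u - v)).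
  split; last by rewrite /A /B; field.
  transitivity (A * (t * u + s * v) - imag ^+ 2 * (s - t) / 2 * (t * u - s * v)).
    by rewrite /B; field.
  by rewrite imag2 /A; field.
have [za zb] := LE a1 a2; have [wa wb] := LE b1 b2.
apply: (@isomorphic_rotation _ _ _ A B c); rewrite ?AB // -/L.
- by apply: listed_mx01; rewrite dx.
- by apply: ord3_ind; rewrite !mxE.
- by rewrite -e0 -e1 za !mxE.
- by rewrite -e0 -e1 zb !mxE.
- by rewrite -e2 !mxE.
- apply: (mulfI st0); transitivity (c ^+ 2 * (s * t * (b1 + b2))); last by rewrite !mxE /=; ring.
  transitivity (A * (s * t * L i0 i2) - B * (s * t * L i1 i2)); first by ring.
  by rewrite -f0 -f1 -wa; ring.
- apply: (mulfI st0); transitivity (c ^+ 2 * (s * t * (imag * (b1 - b2)))).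
    transitivity (B * (s * t * L i0 i2) + A * (s * t * L i1 i2)); first by ring.
    by rewrite -f0 -f1 -wb; ring.
  by rewrite !mxE /=; ring.
by rewrite -f2 !mxE.
Qed.

(** Changing the sign of e_1 exchanges the isotropic vectors f and g. *)
Lemma isotropic_swap :
  isomorphic (evo_alg W) (evo_alg (isotropic_mx a2 a1 z1 b2 b1 w1)).
Proof.
apply: (@isomorphic_monomial _ _ _ _ 1 (fun i => if i == i1 then -1 else 1)).
  by apply: ord3_ind; rewrite /= ?oppr_eq0 oner_neq0.
by do 2![apply: ord3_ind]; rewrite !perm1 !mxE /=; ring.
Qed.

Hypothesis Wi : indep_col W i0 i2.

Lemma isotropic_dep p q : p * (a1 + a2) + q * (b1 + b2) = 0 ->
  p * (a1 - a2) + q * (b1 - b2) = 0 -> p * z1 + q * w1 = 0 -> p = 0 /\ q = 0.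
Proof.
move=> e0 e1 e2; apply: Wi; apply: ord3_ind; rewrite !mxE //=.
by transitivity (imag * (p * (a1 - a2) + q * (b1 - b2))); [ring | rewrite e1 mulr0].
Qed.

Let Jn : imag != 0 := imag_neq0 imag2.

Lemma realize_O : a1 = 0 -> a2 = 0 -> b1 != 0 -> planar_listed W.
Proof.
move=> a10 a20 b10.
have z10 : z1 != 0.
  apply/eqP=> z10; have [|||/eqP] := @isotropic_dep 1 0; rewrite ?oner_eq0 //;
  by rewrite ?a10 ?a20 ?z10; ring.
have JJ : imag * imag = -1 by rewrite -expr2.
have [b20|b20] := eqVneq b2 0.
  have [c [c0 cw]] : exists c, c != 0 /\ (w1 != 0 -> c * w1 = 1).
    have [w10|w10] := eqVneq w1 0; last by exists w1^-1; rewrite invr_eq0 mulVf.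
    by exists 1; rewrite oner_neq0.
  (* The target projection of w is f, so s = c^2 b1; then s t z1 = c gives t. *)
  have s0 : c ^+ 2 * b1 != 0 by rewrite mulf_neq0 ?expf_neq0.
  have t0 : c / (c ^+ 2 * b1 * z1) != 0 by rewrite mulf_neq0 ?invr_neq0 ?mulf_neq0.
  have [w10|w10] := eqVneq w1 0; [apply: (@realize B32 _ _ c s0 t0 c0) => //
    | apply: (@realize B34 _ _ c s0 t0 c0) => //];
    rewrite !mxE /= ?a10 ?a20 ?b20 ?w10 ?cw //; try ring;
    by field; rewrite ?c0 ?b10 ?z10.
(* With s and t as below, s t = 4 c^4 b1 b2. If w1 = 0, making the third coordinate of z equal to 1
   is this cubic equation; otherwise c is spent on w1 and that coordinate becomes the parameter of
   [B33]. *)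
have [c [c0 cP]] : exists c, c != 0 /\ (if w1 == 0 then c ^+ 3 * (4 * b1 * b2 * z1) = 1 else c * w1 = 1).
  have [w10|w10] := eqVneq w1 0; last by exists w1^-1; rewrite invr_eq0 mulVf.
  have k0 : 4 * b1 * b2 * z1 != 0.
    by rewrite !mulf_neq0 // -[4]/(2 * 2)%:R natrM mulf_neq0.
  have [||c cE c0] := @closed_root_neq0 F 3 (4 * b1 * b2 * z1)^-1; rewrite ?invr_neq0 //.
  by exists c; split; rewrite // cE mulVf.
(* The target projection of w is e_1, so t b1 + s b2 = 0 is required. *)
have s0 : 2 * imag * c ^+ 2 * b1 != 0 by rewrite !mulf_neq0 ?expf_neq0.
have t0 : - (2 * imag * c ^+ 2 * b2) != 0 by rewrite oppr_eq0 !mulf_neq0 ?expf_neq0.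
have st : 2 * imag * c ^+ 2 * b1 * - (2 * imag * c ^+ 2 * b2) = 4 * c ^+ 4 * b1 * b2.
  by transitivity (- imag ^+ 2 * (4 * c ^+ 4 * b1 * b2)); [ring | rewrite imag2; ring].
have f1 : c ^+ 2 * imag * (- (2 * imag * c ^+ 2 * b2) * b1 - 2 * imag * c ^+ 2 * b1 * b2)
    = 4 * c ^+ 4 * b1 * b2.
  by transitivity (- imag ^+ 2 * (4 * c ^+ 4 * b1 * b2)); [ring | rewrite imag2; ring].
have [w10|w10] := eqVneq w1 0.
  rewrite w10 eqxx in cP; apply: (@realize B31 _ _ c s0 t0 c0) => //;
    rewrite !mxE /= ?a10 ?a20 ?w10 ?f1 ?st; try ring.
  by transitivity (c * (c ^+ 3 * (4 * b1 * b2 * z1))); [ring | rewrite cP].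
rewrite (negPf w10) in cP.
apply: (@realize (B33 (4 * c ^+ 4 * b1 * b2 * z1 / c)) _ _ c s0 t0 c0) => //;
  rewrite !mxE /= ?a10 ?a20 ?f1 ?st //; try ring.
by field.
Qed.

(** As e_0 = (f + g) / 2, projecting z to e_0 means t a1 = s a2 = 1/2. Then c normalizes the first
    nonzero one among w1, z1 and the e_1-coordinate of w. *)
Lemma realize_E : a1 != 0 -> a2 != 0 -> planar_listed W.
Proof.
move=> a10 a20; pose t := (2 * a1)^-1; pose s := (2 * a2)^-1.
have t0 : t != 0 by rewrite invr_neq0 ?mulf_neq0.
have s0 : s != 0 by rewrite invr_neq0 ?mulf_neq0.
have st0 : s * t != 0 by rewrite mulf_neq0.
have e0 : t * a1 + s * a2 = 1 by rewrite /t /s; field; rewrite two0 a10 a20.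
have e1 : t * a1 - s * a2 = 0 by rewrite /t /s; field; rewrite two0 a10 a20.
have [w10|w10] := eqVneq w1 0; last first.
  have c0 : w1^-1 != 0 by rewrite invr_eq0.
  apply: (@realize (B37 (s * t * z1 * w1) ((w1 ^- 2 * (t * b1 + s * b2)) / (s * t))
    ((w1 ^- 2 * imag * (t * b1 - s * b2)) / (s * t))) _ _ _ s0 t0 c0) => //;
    rewrite !mxE /= ?e0 ?e1 ?mulr0 //; clearbody s t; try by field; rewrite ?w10 ?s0 ?t0.
have [z10|z10] := eqVneq z1 0; last first.
  have c0 : s * t * z1 != 0 by rewrite mulf_neq0.
  apply: (@realize (B35 (((s * t * z1) ^+ 2 * (t * b1 + s * b2)) / (s * t))
    (((s * t * z1) ^+ 2 * imag * (t * b1 - s * b2)) / (s * t))) _ _ _ s0 t0 c0) => //;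
    rewrite !mxE /= ?e0 ?e1 ?mulr0 ?w10 ?mulr1 ?mulr0 //; clearbody s t; by field; rewrite s0 t0.
(* Up to a nonzero factor, this is the e_1-coordinate of the new w. If it were 0, w would be a
   multiple of z, as both third coordinates are 0. *)
pose d := imag * (t * b1 - s * b2).
have d0 : d != 0.
  apply/eqP=> /eqP; rewrite mulf_eq0 (negPf Jn) /= subr_eq0 => /eqP d0.
  have [||| _ /eqP] := @isotropic_dep (t * b1) (- (t * a1)); last first.
  - by rewrite oppr_eq0 mulf_eq0 (negPf t0) (negPf a10).
  - by rewrite z10 w10; ring.
  - transitivity (a1 * (t * b2) - a2 * (t * b1)); first by ring.
    rewrite d0; transitivity (b2 * (t * a1 - s * a2)); first by ring.
    by rewrite e1 mulr0.
  transitivity (- (a1 * (t * b2) - a2 * (t * b1))); first by ring.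
  rewrite d0; transitivity (- (b2 * (t * a1 - s * a2))); first by ring.
  by rewrite e1 mulr0 oppr0.
have [//||c cE c0] := @closed_root_neq0 F 2 (s * t / d).
  by rewrite mulf_neq0 ?invr_neq0.
apply: (@realize (B36 (c ^+ 2 * (t * b1 + s * b2) / (s * t))) _ _ _ s0 t0 c0) => //;
  rewrite !mxE /= ?e0 ?e1 ?mulr0 ?z10 ?w10 ?mulr0 //.
  by rewrite mulrCA mulfV ?mulr1.
by rewrite -mulrA -/d cE divfK ?mulr1.
Qed.

(** Here t = 1 / a1 sends the projection of z to f, while s and c remain free. The coordinates of
    the new w along f and g are c^2 b1 / s and c^2 b2 / t: its target is a multiple of f, of g or,
    when b1 and b2 are nonzero and s is free, of e_0 = (f + g) / 2. *)
Lemma realize_I : a1 != 0 -> a2 = 0 -> planar_listed W.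
Proof.
move=> a10 a20; pose t := a1^-1; have t0 : t != 0 by rewrite invr_neq0.
have ta : t * a1 = 1 by rewrite mulVf.
have [w10|w10] := eqVneq w1 0; last first.
  have c0 : w1^-1 != 0 by rewrite invr_eq0.
  have cw : w1^-1 * w1 = 1 by rewrite mulVf.
  move: w1^-1 => c in c0 cw *.
  have [z10|z10] := eqVneq z1 0; last first.
    have s0 : c / (t * z1) != 0 by rewrite mulf_neq0 ?invr_neq0 ?mulf_neq0.
    apply: (@realize (B312 (c ^+ 2 * (t * b1 + c / (t * z1) * b2) / (c / (t * z1) * t))
     (c ^+ 2 * imag * (t * b1 - c / (t * z1) * b2) / (c / (t * z1) * t))) _ _ _ s0 t0 c0) => //;
     rewrite !mxE /= ?a20 ?mulr0 ?subr0 ?addr0 ?ta ?mulr1 //; clearbody t;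
     by field; rewrite ?c0 ?t0 ?z10.
  have [b10|b10] := eqVneq b1 0.
    apply: (@realize (B315 (c ^+ 2 * b2 / t)) 1 _ _ _ t0 c0); rewrite ?oner_neq0 //;
      rewrite !mxE /= ?a20 ?z10 ?b10 ?mulr0 ?subr0 ?addr0 ?ta ?mulr1 //; clearbody t;
      by field; rewrite ?t0.
  have [b20|b20] := eqVneq b2 0.
    have s0 : c ^+ 2 * b1 != 0 by rewrite mulf_neq0 ?expf_neq0.
    apply: (@realize B314 _ _ _ s0 t0 c0); rewrite ?oner_neq0 //;
      rewrite !mxE /= ?a20 ?z10 ?b20 ?mulr0 ?subr0 ?addr0 ?ta ?mulr1 //; by ring.
  have s0 : t * b1 / b2 != 0 by rewrite mulf_neq0 ?invr_neq0 ?mulf_neq0.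
  apply: (@realize (B313 (2 * c ^+ 2 * b2 / t)) _ _ _ s0 t0 c0) => //.
  - by rewrite !mulf_neq0 ?invr_neq0 ?expf_neq0.
  - by rewrite !mxE /= a20 mulr0 addr0.
  - by rewrite !mxE /= a20 mulr0 subr0 ta mulr1.
  - by rewrite !mxE /= z10 !mulr0.
  - by rewrite !mxE /=; clearbody t; field; rewrite t0 b20.
  - by rewrite !mxE /=; clearbody t; field; rewrite ?t0 b20.
  by rewrite !mxE.
have [z10|z10] := eqVneq z1 0.
  have b20 : b2 != 0.
    apply/eqP=> b20; have [||| _ /eqP] := @isotropic_dep b1 (- a1);
      rewrite ?a20 ?b20 ?z10 ?w10; try ring; by rewrite oppr_eq0 (negPf a10).
  have [b10|b10] := eqVneq b1 0.
    have [//||c cE c0] := @closed_root_neq0 F 2 (t / b2).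
      by rewrite mulf_neq0 ?invr_neq0.
    have cb : c ^+ 2 * b2 = t by rewrite cE divfK.
    apply: (@realize B311 1 _ _ _ t0 c0); rewrite ?oner_neq0 //;
      rewrite !mxE /= ?a20 ?z10 ?b10 ?w10 ?mulr0 ?subr0 ?addr0 ?ta ?mulr1 //.
      by rewrite add0r !mul1r cb.
    by rewrite sub0r !mul1r -[in RHS]cb; ring.
  have s0 : t * b1 / b2 != 0 by rewrite mulf_neq0 ?invr_neq0 ?mulf_neq0.
  have [//||c cE c0] := @closed_root_neq0 F 2 (t / (2 * b2)).
    by rewrite mulf_neq0 ?invr_neq0 ?mulf_neq0.
  apply: (@realize B310 _ _ _ s0 t0 c0) => //;
    rewrite !mxE /= ?a20 ?z10 ?w10 ?mulr0 ?subr0 ?addr0 ?ta ?mulr1 //;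
    rewrite ?cE; clearbody t; by field; rewrite ?t0 ?two0 b20.
have [b10|b10] := eqVneq b1 0.
  have b20 : b2 != 0.
    apply/eqP=> b20; have [||| _ /eqP] := @isotropic_dep 0 1;
      rewrite ?b10 ?b20 ?w10; try ring; by rewrite oner_eq0.
  have [//||c cE c0] := @closed_root_neq0 F 2 (t / b2).
    by rewrite mulf_neq0 ?invr_neq0.
  have s0 : c / (t * z1) != 0 by rewrite mulf_neq0 ?invr_neq0 ?mulf_neq0.
  have cb : c ^+ 2 * b2 = t by rewrite cE divfK.
  apply: (@realize (B39 false) _ _ _ s0 t0 c0) => //;
    rewrite !mxE /= ?a20 ?b10 ?w10 ?mulr0 ?subr0 ?addr0 ?ta ?mulr1 //.
  - by clearbody t; field; rewrite t0 z10.
  - by rewrite add0r mulrCA cb.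
  rewrite sub0r; transitivity (- (c / (t * z1) * imag * (c ^+ 2 * b2))); first by ring.
  by rewrite cb; ring.
have [b20|b20] := eqVneq b2 0.
  (* Solves s t z1 = c with s = c^2 b1. *)
  have c0 : a1 / (z1 * b1) != 0 by rewrite mulf_neq0 ?invr_neq0 ?mulf_neq0.
  set c := a1 / (z1 * b1) in c0.
  have s0 : c ^+ 2 * b1 != 0 by rewrite mulf_neq0 ?expf_neq0.
  apply: (@realize (B39 true) _ _ _ s0 t0 c0) => //;
    rewrite !mxE /= ?a20 ?b20 ?w10 ?mulr0 ?subr0 ?addr0 ?ta ?mulr1 //; try ring.
  by rewrite /c /t; field; rewrite a10 z10 b10.
(* Solves s t z1 = c with s = t b1 / b2, which equalizes the coordinates of w along f and g. *)
have c0 : b1 * z1 / (a1 ^+ 2 * b2) != 0.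
  by rewrite !mulf_neq0 ?invr_neq0 ?mulf_neq0 ?expf_neq0.
set c := b1 * z1 / (a1 ^+ 2 * b2) in c0.
have s0 : t * b1 / b2 != 0 by rewrite mulf_neq0 ?invr_neq0 ?mulf_neq0.
apply: (@realize (B38 (c ^+ 2 * 2 * b2 / t)) _ _ _ s0 t0 c0) => //;
  rewrite !mxE /= ?a20 ?w10 ?mulr0 ?subr0 ?addr0 ?ta ?mulr1 //.
- by rewrite /c /t; field; rewrite a10 b20.
- by clearbody t; field; rewrite t0 b20.
by clearbody t; field; rewrite ?t0 b20.
Qed.
End PlanarExistence.

Section PlanarClassification.
Variables (F : closedFieldType) (imag : F).
Hypotheses (imag2 : imag ^+ 2 = -1) (two0 : 2 != 0 :> F).

Lemma planar_exists (W : 'M[F]_3) : (forall k, W k i1 = W k i0) ->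
  indep_col W i0 i2 -> planar_listed imag W.
Proof.
move=> W01 Wi; have [a1 [a2 [z1 [b1 [b2 [w1 WE]]]]]] := isotropic_mxP imag2 two0 W01.
rewrite {}WE in Wi *.
have swap : planar_listed imag (isotropic_mx imag a2 a1 z1 b2 b1 w1) ->
    planar_listed imag (isotropic_mx imag a1 a2 z1 b1 b2 w1).
  move=> [x [dx x0 xW]]; exists x; split=> //.
  exact: isomorphic_trans (isotropic_swap _ _ _ _ _ _ _) xW.
have Wi' : indep_col (isotropic_mx imag a2 a1 z1 b2 b1 w1) i0 i2.
  move=> p q e; apply: Wi; apply: ord3_ind; rewrite !mxE /=.
  - by have := e i0; rewrite !mxE /= ![a1 + _]addrC ![b1 + _]addrC.
  - have := e i1; rewrite !mxE /= => e1; rewrite -[RHS]oppr0 -[X in _ = - X]e1; ring.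
  - by have := e i2; rewrite !mxE.
have [a10|a10] := eqVneq a1 0; have [a20|a20] := eqVneq a2 0.
- have [b10|b10] := eqVneq b1 0; last exact: realize_O.
  have [b20|b20] := eqVneq b2 0; last by apply: swap; apply: realize_O.
  have [e01 e02] : a1 + a2 = 0 /\ b1 + b2 = 0 by rewrite a10 a20 b10 b20 addr0.
  have [e11 e12] : a1 - a2 = 0 /\ b1 - b2 = 0 by rewrite a10 a20 b10 b20 subrr.
  (* Both columns are now multiples of e_2, hence dependent. *)
  have [||| /eqP w10 _] := @isotropic_dep _ _ _ _ _ _ _ _ Wi w1 (- z1).
  + by rewrite e01 e02; ring.
  + by rewrite e11 e12; ring.
  + by ring.
  have [|||_ /eqP] := @isotropic_dep _ _ _ _ _ _ _ _ Wi 0 1; rewrite ?oner_eq0 //.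
  + by rewrite e01 e02; ring.
  + by rewrite e11 e12; ring.
  + by rewrite (eqP w10); ring.
- by apply: swap; apply: realize_I.
- exact: realize_I.
- exact: realize_E.
Qed.

(** Rescaling e_1 by a square root of 1 / mu makes the first two columns equal and turns [N] into
    [zz]. *)
Lemma planar_classification (W : 'M[F]_3) mu :
    let N := W i0 i0 ^+ 2 + mu * W i1 i0 ^+ 2 in
    mu != 0 -> (forall k, W k i1 = mu * W k i0) -> indep_col W i0 i2 ->
  exists x : listed F, [/\ represented_by imag (evo_alg W) x,
    W i0 i0 = 0 -> W i1 i0 = 0 ->
      planar_num x \in (if W i2 i2 == 0%R then [:: 1; 2] else [:: 3; 4])%N,
    N != 0 -> planar_num x \in (if W i2 i2 == 0%R then [:: 5; 6] else [:: 7])%N &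
    N = 0 -> (W i0 i0 != 0) || (W i1 i0 != 0) ->
      planar_num x \in
        (if W i2 i2 == 0%R then [:: 8; 9; 10; 11] else [:: 12; 13; 14; 15])%N].
Proof.
move=> N mu0 Wmu Wi.
have [//||r rE r0] := @closed_root_neq0 F 2 mu^-1; first by rewrite invr_eq0.
pose c i := if i == i1 then r else 1.
have c0 i : c i != 0 by rewrite /c; case: ifP => _; rewrite ?oner_neq0.
pose V : 'M_3 := \matrix_(k, j) (c j ^+ 2 / c k * W k j).
have VW : isomorphic (evo_alg V) (evo_alg W).
  apply: (@isomorphic_monomial _ _ _ _ 1 c) => // k j.
  by rewrite !perm1 mxE mulrA mulrCA mulfV ?mulr1.
have V01 k : V k i1 = V k i0.
  by rewrite !mxE Wmu -[c i1]/r rE -[c i0]/1; field; rewrite mu0 c0.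
have Vi : indep_col V i0 i2.
  move=> a b e; apply: Wi => k; apply: (mulfI (c0 k)); rewrite mulr0.
  have := e k; rewrite !mxE /c /= expr1n => {}e.
  apply: (mulfI (_ : (c k) ^- 2 != 0)); first by rewrite invr_eq0 expf_neq0.
  by rewrite mulr0 -[RHS]e -/(c k); field; rewrite c0.
have [x [dx x0 Vx]] := planar_exists V01 Vi.
have xi : indep_col (listed_mx imag x) i0 i2.
  apply: indep_col_of_square; first by apply: listed_mx01; rewrite dx.
  have [_ /delta_square_in_line Vsq] := delta21 V01 Vi.
  by move=> xsq; apply/Vsq/(square_in_line_iso Vx).
have x01 : forall k, listed_mx imag x k i1 = listed_mx imag x k i0.
  by apply: listed_mx01; rewrite dx.
have num : planar_num x = planar_code V.
  rewrite -(planar_code_listed imag2 two0) //; apply: planar_code_rel.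
    by apply: planar_iso => //; apply: isomorphic_sym.
  exact: planar_iso.
exists x; rewrite num.
have V22 : (V i2 i2 == 0) = (W i2 i2 == 0) by rewrite mxE /c /= expr1n divr1 mul1r.
have V00 : V i0 i0 = W i0 i0 by rewrite mxE /c /= expr1n divr1 mul1r.
have V10 : V i1 i0 = r^-1 * W i1 i0 by rewrite mxE /c /= expr1n mul1r.
have [c1 c2 c3] := planar_code_cases V22.
have zzN : zz V = N by rewrite /zz V00 V10 /N -[mu]invrK -rE; field.
split.
- split; first exact: admissible21.
  exact: isomorphic_trans (isomorphic_sym VW) Vx.
- by move=> e0 e1; apply: c1; rewrite ?V00 ?V10 ?e1 ?mulr0.
- by rewrite -zzN.
rewrite -zzN => N0 e; apply: c3 => //.
by rewrite V00 V10 mulf_eq0 invr_eq0 (negPf r0).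
Qed.
End PlanarClassification.

(** * Type (3) *)

Section LineClassification.
Variables (F : closedFieldType) (imag : F).
Hypotheses (imag2 : imag ^+ 2 = -1) (two0 : 2 != 0 :> F).

Definition col3 (x y z : F) : 'M[F]_3 :=
  mx_of_rows [:: [:: x; x; x]; [:: y; y; y]; [:: z; z; z]].

Lemma col3_swap01 x y z :
  isomorphic (evo_alg (col3 y x z)) (evo_alg (col3 x y z)).
Proof.
apply: (@isomorphic_monomial _ _ _ _ (tperm i0 i1) (fun=> 1)) => [i|].
  exact: oner_neq0.
by do 2![apply: ord3_ind]; rewrite ?tpermL ?tpermR ?tpermD // !mxE expr1n.
Qed.

Lemma col3_swap12 x y z :
  isomorphic (evo_alg (col3 x z y)) (evo_alg (col3 x y z)).
Proof.
apply: (@isomorphic_monomial _ _ _ _ (tperm i1 i2) (fun=> 1)) => [i|].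
  exact: oner_neq0.
by do 2![apply: ord3_ind]; rewrite ?tpermL ?tpermR ?tpermD // !mxE expr1n.
Qed.

Lemma col3_scale c x y z : c != 0 ->
  isomorphic (evo_alg (col3 (c * x) (c * y) (c * z))) (evo_alg (col3 x y z)).
Proof.
move=> c0; apply: (@isomorphic_monomial _ _ _ _ 1 (fun=> c)) => //.
by do 2![apply: ord3_ind]; rewrite !perm1 !mxE /=; ring.
Qed.

Lemma col3_opp x y z :
  isomorphic (evo_alg (col3 x (- y) z)) (evo_alg (col3 x y z)).
Proof.
apply: (@isomorphic_monomial _ _ _ _ 1 (fun i => if i == i1 then -1 else 1)).
  by apply: ord3_ind; rewrite /= ?oppr_eq0 oner_neq0.
by do 2![apply: ord3_ind]; rewrite !perm1 !mxE /=; ring.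
Qed.

Lemma col3_rotate x y z : x ^+ 2 + y ^+ 2 != 0 -> exists r, [/\ r != 0,
  r ^+ 2 = x ^+ 2 + y ^+ 2 & isomorphic (evo_alg (col3 r 0 z)) (evo_alg (col3 x y z))].
Proof.
move=> xy0; have [//||r rE r0] := @closed_root_neq0 F 2 (x ^+ 2 + y ^+ 2) => //.
exists r; split=> //.
have ab : (x / r) ^+ 2 + (y / r) ^+ 2 = 1.
  by rewrite !exprMn -mulrDl -rE -exprMn mulfV ?expr1n.
apply: (@isomorphic_rotation _ _ _ (x / r) (y / r) 1); rewrite ?ab ?oner_neq0 //;
  try (by apply: ord3_ind; rewrite !mxE); rewrite !mxE /=; by field.
Qed.

(** If the three sums of two squares vanished, so would 2 x^2 and then all coordinates; hence some
    two coordinates can be rotated onto one axis. Of the remaining r and w, the case w = i r or w =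
    - i r leads to [I3]; otherwise a second rotation leads to [E3]. *)
Lemma line_exists x y z : [|| x != 0, y != 0 | z != 0] ->
  exists a : listed F, listed_delta a = [:: 3]%N /\
    isomorphic (evo_alg (col3 x y z)) (listed_alg imag a).
Proof.
pose P x y z := exists a : listed F, listed_delta a = [:: 3]%N /\
    isomorphic (evo_alg (col3 x y z)) (listed_alg imag a).
have Pt x' y' z' u v w : isomorphic (evo_alg (col3 u v w)) (evo_alg (col3 x' y' z')) ->
    P u v w -> P x' y' z'.
  move=> uvw [a [da ia]]; exists a; split=> //.
  exact: isomorphic_trans (isomorphic_sym uvw) ia.
have Prot u v w : u ^+ 2 + v ^+ 2 != 0 -> P u v w.
  move=> /(col3_rotate w)[r [r0 rE /Pt]]; apply.
  apply: (Pt _ _ _ _ _ _ (col3_swap12 r 0 w)); have [rw|rw] := eqVneq (r ^+ 2 + w ^+ 2) 0.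
    have PI : P r (imag * r) 0.
      apply: (Pt _ _ _ _ _ _ (col3_scale r (imag * r) 0 (_ : r^-1 != 0))).
        by rewrite invr_eq0.
      exists I3; split=> //; suff -> : col3 (r^-1 * r) (r^-1 * (imag * r)) (r^-1 * 0) =
        listed_mx imag I3 by exact: isomorphic_refl.
      by apply/matrixP; do 2![apply: ord3_ind]; rewrite !mxE /=; field.
    have : w ^+ 2 == (imag * r) ^+ 2.
      by rewrite exprMn imag2 mulN1r -addr_eq0 addrC rw.
    by rewrite eqf_sqr => /orP[]/eqP-> //; apply: (Pt _ _ _ _ _ _ (col3_opp _ _ _)); rewrite opprK.
  have [r' [r'0 _ /Pt]] := col3_rotate 0 rw; apply.
  apply: (Pt _ _ _ _ _ _ (col3_scale r' 0 0 (_ : r'^-1 != 0))).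
    by rewrite invr_eq0.
  exists E3; split=> //; suff -> : col3 (r'^-1 * r') (r'^-1 * 0) (r'^-1 * 0) =
    listed_mx imag E3 by exact: isomorphic_refl.
  by apply/matrixP; do 2![apply: ord3_ind]; rewrite !mxE /=; field.
move=> nz; rewrite -/(P x y z).
have [xy|/Prot//] := eqVneq (x ^+ 2 + y ^+ 2) 0.
have [xz|xz] := eqVneq (x ^+ 2 + z ^+ 2) 0; last by apply: (Pt _ _ _ _ _ _ (col3_swap12 _ _ _)); apply: Prot.
have [yz|yz] := eqVneq (y ^+ 2 + z ^+ 2) 0; last first.
  apply: (Pt _ _ _ _ _ _ (col3_swap01 _ _ _)).
  by apply: (Pt _ _ _ _ _ _ (col3_swap12 _ _ _)); apply: Prot.
have x0 : x = 0.
  apply/eqP; rewrite -sqrf_eq0; apply/eqP; apply: (mulfI two0).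
  transitivity ((x ^+ 2 + y ^+ 2) + (x ^+ 2 + z ^+ 2) - (y ^+ 2 + z ^+ 2)); first by ring.
  by rewrite xy xz yz; ring.
move/eqP: xy; move/eqP: xz; rewrite x0 expr0n !add0r !sqrf_eq0 => /eqP z0 /eqP y0.
by rewrite x0 y0 z0 eqxx in nz.
Qed.

Lemma line_classification (W : 'M[F]_3) mu nu : mu != 0 -> nu != 0 ->
    (forall k, W k i1 = mu * W k i0) -> (forall k, W k i2 = nu * W k i0) ->
    (exists k, W k i0 != 0) ->
  exists x : listed F, represented_by imag (evo_alg W) x /\ listed_delta x = [:: 3]%N.
Proof.
move=> mu0 nu0 Wmu Wnu [k0 Wk0].
have [//||r rE r0] := @closed_root_neq0 F 2 mu^-1; first by rewrite invr_eq0.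
have [//||t tE t0] := @closed_root_neq0 F 2 nu^-1; first by rewrite invr_eq0.
pose c i := if i == i1 then r else if i == i2 then t else 1.
have c0 : forall i, c i != 0 by apply: ord3_ind; rewrite /c //= oner_neq0.
pose V := col3 (W i0 i0) (W i1 i0 / r) (W i2 i0 / t).
have VW : isomorphic (evo_alg V) (evo_alg W).
  apply: (@isomorphic_monomial _ _ _ _ 1 c) => //.
  by do 2![apply: ord3_ind]; rewrite !perm1 !mxE /c /= ?rE ?tE ?Wmu ?Wnu ?expr1n; field;
    rewrite ?r0 ?t0 ?mu0 ?nu0.
have [|x [dx Vx]] := @line_exists (W i0 i0) (W i1 i0 / r) (W i2 i0 / t).
  rewrite !mulf_eq0 !invr_eq0 (negPf r0) (negPf t0) !orbF.
  by move: k0 Wk0; apply: ord3_ind => ->; rewrite ?orbT.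
exists x; split=> //; split; first exact: admissible3.
exact: isomorphic_trans (isomorphic_sym VW) Vx.
Qed.
End LineClassification.

(** * Type (1, 1, 1) *)

Section ScatteredCode.
Variable F : fieldType.
Implicit Types V W : 'M[F]_3.

Definition zero_diag W := (\sum_j (W j j == 0%R))%N.
Definition idem_links W := (\sum_j \sum_k ((W k k != 0%R) && (W k j != 0%R)))%N.
Definition zero_row W := [exists k, [forall j, W k j == 0]].

(** Depends only on the zero pattern, up to permuting rows and columns alike. If a single diagonal
    entry is nonzero, [idem_links] counts the nonzero entries of its row: 3, 2 and 1 on [A33], [A34]
    and [A35]. *)
Definition scattered_code W : nat :=
  if zero_diag W == 3 then (if zero_row W then 2 else 1)
  else if zero_diag W == 2 then (6 - idem_links W)%N
  else (7 - zero_diag W)%N.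

Lemma scattered_code_perm V W (s : 'S_3) :
  (forall k j, (V k j == 0) = (W (s k) (s j) == 0)) ->
  scattered_code V = scattered_code W.
Proof.
move=> VW.
have e0 : zero_diag V = zero_diag W.
  rewrite /zero_diag [RHS](reindex_inj (@perm_inj _ s)) /=.
  by apply: eq_bigr => j _; rewrite VW.
have e1 : idem_links V = idem_links W.
  rewrite /idem_links [RHS](reindex_inj (@perm_inj _ s)) /=.
  apply: eq_bigr => j _; rewrite [RHS](reindex_inj (@perm_inj _ s)) /=.
  by apply: eq_bigr => k _; rewrite !VW.
have e2 : zero_row V = zero_row W.
  apply/existsP/existsP => -[k /forallP Vk].
    exists (s k); apply/forallP=> j; rewrite -(permKV s j) -VW; exact: Vk.
  exists ((s^-1)%g k); apply/forallP=> j; rewrite VW permKV; exact: Vk.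
by rewrite /scattered_code e0 e1 e2.
Qed.
End ScatteredCode.

Definition scattered_num (F : Type) (x : listed F) : nat :=
  match x with
  | A31 _ _ _ => 1 | A32 _ => 2 | A33 _ _ _ _ => 3 | A34 _ _ _ => 4
  | A35 _ _ => 5 | A36 _ _ _ _ _ => 6 | A37 _ _ _ _ _ _ => 7 | _ => 0
  end.

Lemma scattered_code_listed (F : fieldType) (imag : F) (x : listed F) :
  listed_delta x = [:: 1; 1; 1]%N ->
  scattered_code (listed_mx imag x) = scattered_num x.
Proof.
rewrite /scattered_code /zero_diag /idem_links.
case: x => //= [a b c|a|a b c e|a b c|a b|a b c e z|a b c e z x] _;
  rewrite !sum3E !mxE /= ?eqxx ?oner_eq0 //=.
- rewrite ifF //; apply/existsP => -[k /forallP].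
  move: k; apply: ord3_ind => [/(_ i1)|/(_ i2)|/(_ i0)]; by rewrite mxE /= oner_eq0.
- rewrite ifT //; apply/existsP; exists i0; apply/forallP.
  by apply: ord3_ind; rewrite mxE.
Qed.

(** * Normal forms in type (1, 1, 1) *)

Section ScatteredExistence.
Variables (F : closedFieldType) (imag : F).
Implicit Types W : 'M[F]_3.

Lemma represented_monomial W x (s : 'S_3) (c : 'I_3 -> F) :
  indep_cols W -> listed_delta x = [:: 1; 1; 1]%N -> (forall j, c j != 0) ->
  (forall k j, c k * listed_mx imag x k j = c j ^+ 2 * W (s k) (s j)) ->
  represented_by imag (evo_alg W) x.
Proof.
move=> Wi dx c0 xW; have xW' := isomorphic_monomial c0 xW.
split; last exact: isomorphic_sym.
exact/admissible111/(indep_cols_iso Wi).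
Qed.

Definition perm_mx2 (s : 'S_3) W : 'M[F]_3 := \matrix_(k, j) W (s k) (s j).

Lemma perm_mx2_iso s W : isomorphic (evo_alg (perm_mx2 s W)) (evo_alg W).
Proof.
apply: (@isomorphic_monomial _ _ _ _ s (fun=> 1)) => [_|k j]; first exact: oner_neq0.
by rewrite mxE expr1n.
Qed.

Lemma represented_iso (A B : naAlgebra F) x :
  isomorphic A B -> represented_by imag A x -> represented_by imag B x.
Proof.
by move=> AB [xa Ax]; split=> //; apply: isomorphic_trans (isomorphic_sym AB) Ax.
Qed.

Lemma perm_mx2_indep s W : indep_cols W -> indep_cols (perm_mx2 s W).
Proof. by move=> Wi; apply: (indep_cols_iso Wi); apply: perm_mx2_iso. Qed.

(** The rescaling that turns a nonzero diagonal entry [a] into 1. *)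
Lemma inverse_witness (a : F) : a != 0 -> exists2 c, c = c ^+ 2 * a & c != 0.
Proof. by exists a^-1; [rewrite expr2 mulfVK | rewrite invr_neq0]. Qed.

Section Entries.
Variable W : 'M[F]_3.
Hypothesis Wi : indep_cols W.

Lemma indep_cols_nonzero j : ~ (forall k, W k j = 0).
Proof.
move=> W0; have [k jk _] := third_index (isT : i0 != i1).
suff [i ji] : exists i, j != i.
  have [[l]] := indep_col_neq0 (Wi ji); by rewrite W0 eqxx.
by move: j {W0}; apply: ord3_ind; [exists i1 | exists i0 | exists i0].
Qed.

Lemma represented_scale x c0 c1 c2 :
  let c := fun i : 'I_3 => [:: c0; c1; c2]`_i in
  listed_delta x = [:: 1; 1; 1]%N -> c0 != 0 -> c1 != 0 -> c2 != 0 ->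
  (forall k j, c k * listed_mx imag x k j = c j ^+ 2 * W k j) ->
  represented_by imag (evo_alg W) x.
Proof.
move=> c dx n0 n1 n2 xW; apply: (@represented_monomial W x 1 c) => //.
  by apply: ord3_ind.
by move=> k j; rewrite !perm1.
Qed.

(** The unit entries of [A31] demand c2 = c0^2 W20, c1 = c2^2 W12 and c0 = c1^2 W01; eliminating c1
    and c2 leaves an equation for c0^7. *)
Lemma represented_cycle : W i0 i0 = 0 -> W i1 i1 = 0 -> W i2 i2 = 0 ->
    W i2 i0 != 0 -> W i1 i2 != 0 -> W i0 i1 != 0 ->
  exists a b c, represented_by imag (evo_alg W) (A31 a b c).
Proof.
move=> d0 d1 d2 w20 w12 w01.
have [//||c0 c0E n0] := @closed_root_neq0 F 7 (W i2 i0 ^+ 4 * W i1 i2 ^+ 2 * W i0 i1)^-1.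
  by rewrite invr_neq0 ?mulf_neq0 ?expf_neq0.
pose c2 := c0 ^+ 2 * W i2 i0; pose c1 := c2 ^+ 2 * W i1 i2.
have n2 : c2 != 0 by rewrite mulf_neq0 ?expf_neq0.
have n1 : c1 != 0 by rewrite mulf_neq0 ?expf_neq0.
exists (c2 ^+ 2 * W i0 i2 / c0), (c0 ^+ 2 * W i1 i0 / c1), (c1 ^+ 2 * W i2 i1 / c2).
apply: (@represented_scale _ c0 c1 c2) => //.
do 2![apply: ord3_ind]; rewrite !mxE /= ?d0 ?d1 ?d2 ?mulr0 ?mulr1 // ?[_ * (_ / _)]mulrC ?divfK //.
transitivity (c0 * (c0 ^+ 7 * (W i2 i0 ^+ 4 * W i1 i2 ^+ 2 * W i0 i1))).
  by rewrite c0E mulVf ?mulr1 ?mulf_neq0 ?expf_neq0.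
by rewrite /c1 /c2; ring.
Qed.

(** The 2-cycle between e_1 and e_2 determines c1^3, and then c2 = c0^2 W20 determines c0^2. *)
Lemma represented_source : W i0 i0 = 0 -> W i1 i1 = 0 -> W i2 i2 = 0 ->
    W i0 i1 = 0 -> W i0 i2 = 0 -> W i2 i0 != 0 -> W i1 i2 != 0 -> W i2 i1 != 0 ->
  exists a, represented_by imag (evo_alg W) (A32 a).
Proof.
move=> d0 d1 d2 w01 w02 w20 w12 w21.
have [//||c1 c1E n1] := @closed_root_neq0 F 3 (W i2 i1 ^+ 2 * W i1 i2)^-1.
  by rewrite invr_neq0 ?mulf_neq0 ?expf_neq0.
pose c2 := c1 ^+ 2 * W i2 i1; have n2 : c2 != 0 by rewrite mulf_neq0 ?expf_neq0.
have [//||c0 c0E n0] := @closed_root_neq0 F 2 (c2 / W i2 i0).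
  by rewrite mulf_neq0 ?invr_neq0.
exists (c0 ^+ 2 * W i1 i0 / c1); apply: (@represented_scale _ c0 c1 c2) => //.
do 2![apply: ord3_ind]; rewrite !mxE /= ?d0 ?d1 ?d2 ?w01 ?w02 ?mulr0 ?mulr1 //
  ?[_ * (_ / _)]mulrC ?divfK //.
- transitivity (c1 * (c1 ^+ 3 * (W i2 i1 ^+ 2 * W i1 i2))).
    by rewrite c1E mulVf ?mulr1 ?mulf_neq0 ?expf_neq0.
  by rewrite /c2; ring.
by rewrite c0E divfK.
Qed.

Lemma represented_A33 : W i0 i0 = 0 -> W i1 i1 = 0 -> W i2 i2 != 0 ->
    W i2 i0 != 0 -> W i2 i1 != 0 ->
  exists a b c e, represented_by imag (evo_alg W) (A33 a b c e).
Proof.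
move=> d0 d1 d2 w20 w21; have [c2 c2E n2] := inverse_witness d2.
have [//||c0 c0E n0] := @closed_root_neq0 F 2 (c2 / W i2 i0).
  by rewrite mulf_neq0 ?invr_neq0.
have [//||c1 c1E n1] := @closed_root_neq0 F 2 (c2 / W i2 i1).
  by rewrite mulf_neq0 ?invr_neq0.
exists (c1 ^+ 2 * W i0 i1 / c0), (c2 ^+ 2 * W i0 i2 / c0).
exists (c0 ^+ 2 * W i1 i0 / c1), (c2 ^+ 2 * W i1 i2 / c1).
apply: (@represented_scale _ c0 c1 c2) => //.
do 2![apply: ord3_ind]; rewrite !mxE /= ?d0 ?d1 ?mulr0 ?mulr1 // ?[_ * (_ / _)]mulrC ?divfK //.
- by rewrite c0E divfK.
- by rewrite c1E divfK.
Qed.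

Lemma represented_A34 : W i0 i0 = 0 -> W i1 i1 = 0 -> W i2 i2 != 0 ->
    W i2 i0 = 0 -> W i2 i1 != 0 ->
  exists a b c, represented_by imag (evo_alg W) (A34 a b c).
Proof.
move=> d0 d1 d2 w20 w21; have [c2 c2E n2] := inverse_witness d2.
have w10 : W i1 i0 != 0.
  apply/eqP=> w10; apply: (@indep_cols_nonzero i0); exact: ord3_ind.
have [//||c1 c1E n1] := @closed_root_neq0 F 2 (c2 / W i2 i1).
  by rewrite mulf_neq0 ?invr_neq0.
have [//||c0 c0E n0] := @closed_root_neq0 F 2 (c1 / W i1 i0).
  by rewrite mulf_neq0 ?invr_neq0.
exists (c1 ^+ 2 * W i0 i1 / c0), (c2 ^+ 2 * W i0 i2 / c0), (c2 ^+ 2 * W i1 i2 / c1).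
apply: (@represented_scale _ c0 c1 c2) => //.
do 2![apply: ord3_ind]; rewrite !mxE /= ?d0 ?d1 ?w20 ?mulr0 ?mulr1 //
  ?[_ * (_ / _)]mulrC ?divfK //.
- by rewrite c0E divfK.
- by rewrite c1E divfK.
Qed.

Lemma represented_A35 : W i0 i0 = 0 -> W i1 i1 = 0 -> W i2 i2 != 0 ->
    W i2 i0 = 0 -> W i2 i1 = 0 ->
  exists a b, represented_by imag (evo_alg W) (A35 a b).
Proof.
move=> d0 d1 d2 w20 w21; have [c2 c2E n2] := inverse_witness d2.
have w10 : W i1 i0 != 0.
  apply/eqP=> w10; apply: (@indep_cols_nonzero i0); exact: ord3_ind.
have w01 : W i0 i1 != 0.
  apply/eqP=> w01; apply: (@indep_cols_nonzero i1); exact: ord3_ind.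
(* From c1 = c0^2 W10 and c0 = c1^2 W01. *)
have [//||c0 c0E n0] := @closed_root_neq0 F 3 (W i1 i0 ^+ 2 * W i0 i1)^-1.
  by rewrite invr_neq0 ?mulf_neq0 ?expf_neq0.
pose c1 := c0 ^+ 2 * W i1 i0; have n1 : c1 != 0 by rewrite mulf_neq0 ?expf_neq0.
exists (c2 ^+ 2 * W i0 i2 / c0), (c2 ^+ 2 * W i1 i2 / c1).
apply: (@represented_scale _ c0 c1 c2) => //.
do 2![apply: ord3_ind]; rewrite !mxE /= ?d0 ?d1 ?w20 ?w21 ?mulr0 ?mulr1 //
  ?[_ * (_ / _)]mulrC ?divfK //.
- transitivity (c0 * (c0 ^+ 3 * (W i1 i0 ^+ 2 * W i0 i1))).
    by rewrite c0E mulVf ?mulr1 ?mulf_neq0 ?expf_neq0.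
  by rewrite /c1; ring.
Qed.

Lemma represented_A36 : W i0 i0 = 0 -> W i1 i1 != 0 -> W i2 i2 != 0 -> W i1 i0 != 0 ->
  exists a b c e z, represented_by imag (evo_alg W) (A36 a b c e z).
Proof.
move=> d0 d1 d2 w10; have [c1 c1E n1] := inverse_witness d1; have [c2 c2E n2] := inverse_witness d2.
have [//||c0 c0E n0] := @closed_root_neq0 F 2 (c1 / W i1 i0).
  by rewrite mulf_neq0 ?invr_neq0.
exists (c1 ^+ 2 * W i0 i1 / c0), (c2 ^+ 2 * W i0 i2 / c0), (c2 ^+ 2 * W i1 i2 / c1).
exists (c0 ^+ 2 * W i2 i0 / c2), (c1 ^+ 2 * W i2 i1 / c2).
apply: (@represented_scale _ c0 c1 c2) => //.
do 2![apply: ord3_ind]; rewrite !mxE /= ?d0 ?mulr0 ?mulr1 // ?[_ * (_ / _)]mulrC ?divfK //.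
- by rewrite c0E divfK.
Qed.

Lemma represented_A37 : W i0 i0 != 0 -> W i1 i1 != 0 -> W i2 i2 != 0 ->
  exists a b c e z x, represented_by imag (evo_alg W) (A37 a b c e z x).
Proof.
move=> d0 d1 d2.
have [c0 c0E n0] := inverse_witness d0.
have [c1 c1E n1] := inverse_witness d1; have [c2 c2E n2] := inverse_witness d2.
exists (c1 ^+ 2 * W i0 i1 / c0), (c2 ^+ 2 * W i0 i2 / c0), (c0 ^+ 2 * W i1 i0 / c1).
exists (c2 ^+ 2 * W i1 i2 / c1), (c0 ^+ 2 * W i2 i0 / c2), (c1 ^+ 2 * W i2 i1 / c2).
apply: (@represented_scale _ c0 c1 c2) => //.
do 2![apply: ord3_ind]; rewrite !mxE /= ?mulr0 ?mulr1 // ?[_ * (_ / _)]mulrC ?divfK //.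
Qed.
End Entries.

Lemma indep_cols_support W i j k : indep_cols W -> i != j ->
  (forall l, l != k -> W l i = 0 /\ W l j = 0) -> False.
Proof.
move=> Wi ij W0; have [l|_ /eqP] := Wi i j ij (W k j) (- W k i).
  have [->|/W0[-> ->]] := eqVneq l k; last by rewrite !mulr0 addr0.
  by rewrite mulNr mulrC subrr.
rewrite oppr_eq0 => /eqP Wk; apply: (indep_cols_nonzero Wi (j := i)) => l.
by have [->|/W0[]] := eqVneq l k.
Qed.

(* Each pair {i, j} is linked by W i j or W j i, since otherwise columns i and j
   would be parallel, and no column is 0. So either W has a 3-cycle, or some row
   is 0 and all the other entries off the diagonal are nonzero. *)
Lemma represented_OOO W : indep_cols W ->
  W i0 i0 = 0 -> W i1 i1 = 0 -> W i2 i2 = 0 ->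
  (exists a b c, represented_by imag (evo_alg W) (A31 a b c)) \/
  (exists a, represented_by imag (evo_alg W) (A32 a)).
Proof.
move=> Wi d0 d1 d2.
(* The opposite 3-cycle; exchanging e_0 and e_1 reverses it. *)
have perm_cycle : W i2 i1 != 0 -> W i0 i2 != 0 -> W i1 i0 != 0 ->
    exists a b c, represented_by imag (evo_alg W) (A31 a b c).
  move=> w21 w02 w10; have Wp := @perm_mx2_indep (tperm i0 i1) W Wi.
  have [||||||a [b [c r]]] := represented_cycle Wp;
    rewrite ?mxE ?tpermL ?tpermR ?tpermD //.
  by exists a, b, c; apply: represented_iso r; apply: perm_mx2_iso.
(* Here and in [source2] a transposition moves the zero row to the top. *)
have source1 : W i1 i0 = 0 -> W i1 i2 = 0 -> W i2 i1 != 0 -> W i0 i2 != 0 ->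
    W i2 i0 != 0 -> exists a, represented_by imag (evo_alg W) (A32 a).
  move=> w10 w12 w21 w02 w20; have Wp := @perm_mx2_indep (tperm i0 i1) W Wi.
  have [||||||||a r] := represented_source Wp; rewrite ?mxE ?tpermL ?tpermR ?tpermD //.
  by exists a; apply: represented_iso r; apply: perm_mx2_iso.
have source2 : W i2 i1 = 0 -> W i2 i0 = 0 -> W i0 i2 != 0 -> W i1 i0 != 0 ->
    W i0 i1 != 0 -> exists a, represented_by imag (evo_alg W) (A32 a).
  move=> w21 w20 w02 w10 w01; have Wp := @perm_mx2_indep (tperm i0 i2) W Wi.
  have [||||||||a r] := represented_source Wp; rewrite ?mxE ?tpermL ?tpermR ?tpermD //.
  by exists a; apply: represented_iso r; apply: perm_mx2_iso.
have link01 : W i0 i1 = 0 -> W i1 i0 = 0 -> False.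
  by move=> e e'; apply: (indep_cols_support (k := i2) Wi (isT : i0 != i1)); apply: ord3_ind.
have link02 : W i0 i2 = 0 -> W i2 i0 = 0 -> False.
  by move=> e e'; apply: (indep_cols_support (k := i1) Wi (isT : i0 != i2)); apply: ord3_ind.
have link12 : W i1 i2 = 0 -> W i2 i1 = 0 -> False.
  by move=> e e'; apply: (indep_cols_support (k := i0) Wi (isT : i1 != i2)); apply: ord3_ind.
have nz0 : W i1 i0 = 0 -> W i2 i0 = 0 -> False.
  by move=> e e'; apply: (indep_cols_nonzero Wi (j := i0)); apply: ord3_ind.
have nz1 : W i0 i1 = 0 -> W i2 i1 = 0 -> False.
  by move=> e e'; apply: (indep_cols_nonzero Wi (j := i1)); apply: ord3_ind.
have nz2 : W i0 i2 = 0 -> W i1 i2 = 0 -> False.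
  by move=> e e'; apply: (indep_cols_nonzero Wi (j := i2)); apply: ord3_ind.
have cycle := represented_cycle Wi d0 d1 d2.
have source0 := represented_source Wi d0 d1 d2.
(* All 64 zero patterns off the diagonal. *)
have [e01|n01] := eqVneq (W i0 i1) 0; have [e02|n02] := eqVneq (W i0 i2) 0;
have [e10|n10] := eqVneq (W i1 i0) 0; have [e12|n12] := eqVneq (W i1 i2) 0;
have [e20|n20] := eqVneq (W i2 i0) 0; have [e21|n21] := eqVneq (W i2 i1) 0;
  by [left; apply: cycle | left; apply: perm_cycle | right; apply: source0
    | right; apply: source1 | right; apply: source2
    | case: link01 | case: link02 | case: link12 | case: nz0 | case: nz1 | case: nz2].
Qed.

Lemma represented_OOE W : indep_cols W ->
  W i0 i0 = 0 -> W i1 i1 = 0 -> W i2 i2 != 0 ->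
  [\/ exists a b c e, represented_by imag (evo_alg W) (A33 a b c e),
      exists a b c, represented_by imag (evo_alg W) (A34 a b c) |
      exists a b, represented_by imag (evo_alg W) (A35 a b)].
Proof.
move=> Wi d0 d1 d2.
have [w20|w20] := eqVneq (W i2 i0) 0; have [w21|w21] := eqVneq (W i2 i1) 0.
- by apply: Or33; apply: represented_A35.
- by apply: Or32; apply: represented_A34.
- have Wp := @perm_mx2_indep (tperm i0 i1) W Wi.
  have [|||||a [b [c r]]] := represented_A34 Wp; rewrite ?mxE ?tpermL ?tpermR ?tpermD //.
  by apply: Or32; exists a, b, c; apply: represented_iso r; apply: perm_mx2_iso.
- by apply: Or31; apply: represented_A33.
Qed.

Lemma represented_OEE W : indep_cols W ->
  W i0 i0 = 0 -> W i1 i1 != 0 -> W i2 i2 != 0 ->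
  exists a b c e z, represented_by imag (evo_alg W) (A36 a b c e z).
Proof.
move=> Wi d0 d1 d2.
have [w10|w10] := eqVneq (W i1 i0) 0; last exact: represented_A36.
have Wp := @perm_mx2_indep (tperm i1 i2) W Wi.
have [||||a [b [c [e [z r]]]]] := represented_A36 Wp; rewrite ?mxE ?tpermL ?tpermR ?tpermD //.
  by apply/eqP=> w20; apply: (indep_cols_nonzero Wi (j := i0)); apply: ord3_ind.
by exists a, b, c, e, z; apply: represented_iso r; apply: perm_mx2_iso.
Qed.

(** A single transposition suffices to put the zeros of the diagonal first. *)
Lemma scattered_exists W : indep_cols W ->
  exists x, represented_by imag (evo_alg W) x.
Proof.
have OOO W' : indep_cols W' -> W' i0 i0 = 0 -> W' i1 i1 = 0 -> W' i2 i2 = 0 ->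
    exists x, represented_by imag (evo_alg W') x.
  move=> Wi d0 d1 d2; have [[a [b [c r]]]|[a r]] := represented_OOO Wi d0 d1 d2.
    by exists (A31 a b c).
  by exists (A32 a).
have OOE W' : indep_cols W' -> W' i0 i0 = 0 -> W' i1 i1 = 0 -> W' i2 i2 != 0 ->
    exists x, represented_by imag (evo_alg W') x.
  move=> Wi d0 d1 d2; have [[a [b [c [e r]]]]|[a [b [c r]]]|[a [b r]]] :=
    represented_OOE Wi d0 d1 d2.
  - by exists (A33 a b c e).
  - by exists (A34 a b c).
  by exists (A35 a b).
have OEE W' : indep_cols W' -> W' i0 i0 = 0 -> W' i1 i1 != 0 -> W' i2 i2 != 0 ->
    exists x, represented_by imag (evo_alg W') x.
  move=> Wi d0 d1 d2; have [a [b [c [e [z r]]]]] := represented_OEE Wi d0 d1 d2.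
  by exists (A36 a b c e z).
move=> Wi; have perm i j : (exists x, represented_by imag (evo_alg (perm_mx2 (tperm i j) W)) x) ->
    exists x, represented_by imag (evo_alg W) x.
  by move=> [x r]; exists x; apply: represented_iso r; apply: perm_mx2_iso.
have Wp i j := @perm_mx2_indep (tperm i j) W Wi.
have pE i j k : perm_mx2 (tperm i j) W k k = W (tperm i j k) (tperm i j k) by rewrite mxE.
have [d0|d0] := eqVneq (W i0 i0) 0; have [d1|d1] := eqVneq (W i1 i1) 0;
have [d2|d2] := eqVneq (W i2 i2) 0.
- exact: OOO.
- exact: OOE.
- by apply: (perm i1 i2); apply: OOE (Wp _ _) _ _ _; rewrite pE ?tpermL ?tpermR ?tpermD.
- exact: OEE.
- by apply: (perm i0 i2); apply: OOE (Wp _ _) _ _ _; rewrite pE ?tpermL ?tpermR ?tpermD.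
- by apply: (perm i0 i1); apply: OEE (Wp _ _) _ _ _; rewrite pE ?tpermL ?tpermR ?tpermD.
- by apply: (perm i0 i2); apply: OEE (Wp _ _) _ _ _; rewrite pE ?tpermL ?tpermR ?tpermD.
have [a [b [c [e [z [x r]]]]]] := represented_A37 Wi d0 d1 d2.
by exists (A37 a b c e z x).
Qed.
End ScatteredExistence.

(** * The classification *)

Lemma indep_col_sym (F : fieldType) n (W : 'M[F]_n) i j : indep_col W i j -> indep_col W j i.
Proof. by move=> Wij a b e; have [|-> ->] := Wij b a => // k; rewrite addrC. Qed.

Lemma col_dichotomy (F : fieldType) n (W : 'M[F]_n) i j :
  (exists k, W k i != 0) -> (exists k, W k j != 0) ->
  indep_col W i j \/ exists2 mu, mu != 0 & forall k, W k j = mu * W k i.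
Proof.
move=> [k Wk] [l Wl]; pose mu := W k j / W k i.
have [/forallP Wmu|] := boolP [forall m, W m j == mu * W m i].
  right; exists mu => [|m]; last exact/eqP.
  by apply: contraNneq Wl => mu0; rewrite (eqP (Wmu l)) mu0 mul0r.
rewrite negb_forall => /existsP[m Wm]; left=> a b e.
have b0 : b = 0.
  apply: (mulIf (_ : W m j - mu * W m i != 0)); first by rewrite subr_eq0.
  rewrite mul0r /mu; transitivity ((a * W m i + b * W m j) - (W m i / W k i) * (a * W k i + b * W k j)).
    by field.
  by rewrite !e mulr0 subr0.
split=> //; apply: (mulIf Wk); rewrite mul0r -[RHS](e k) b0; ring.
Qed.

Lemma delta3_square_in_line (F : fieldType) (A : naAlgebra F) :
  delta_index A [:: 3]%N -> square_in_line A.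
Proof.
move=> [_ [E [[_ sE _ d1 _] _]]].
have fullE : E ord0 = fullv by rewrite -sE big_ord_recl big_ord0 addv0.
exists (vpick (mul_space (E ord0) (E ord0))) => x y.
set U := mul_space _ _; have <- : U = <[vpick U]>%VS.
  by apply/esym/eqP; rewrite eqEdim (d1 ord0) dim_vline vpick0 -dimv_eq0 (d1 ord0) andbT -memvE memv_pick.
by apply: mem_mul_space; rewrite fullE memvf.
Qed.

Section Classification.
Variables (F : closedFieldType) (imag : F).
Hypotheses (imag2 : imag ^+ 2 = -1) (two0 : 2 != 0 :> F).

(** If two columns are proportional, they are moved to the first two places and the third column
    decides between delta-index (2,1) and (3); otherwise all pairs are independent. *)
Lemma evo_represented (W : 'M[F]_3) : (forall j, exists k, W k j != 0) ->
  exists x, represented_by imag (evo_alg W) x.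
Proof.
have first_two (W' : 'M[F]_3) : (forall j, exists k, W' k j != 0) ->
    (exists2 mu, mu != 0 & forall k, W' k i1 = mu * W' k i0) ->
    exists x, represented_by imag (evo_alg W') x.
  move=> W0 [mu mu0 Wmu].
  have [Wi|[nu nu0 Wnu]] := col_dichotomy (W0 i0) (W0 i2).
    by have [x [r _ _ _]] := planar_classification imag2 two0 mu0 Wmu Wi; exists x.
  have [x [r _]] := line_classification imag2 two0 mu0 nu0 Wmu Wnu (W0 i0).
  by exists x.
move=> W0.
have perm i j : (exists2 mu, mu != 0 &
      forall k, W k (tperm i j i1) = mu * W k (tperm i j i0)) ->
    exists x, represented_by imag (evo_alg W) x.
  move=> [mu mu0 Wmu]; have [||x r] := first_two (perm_mx2 (tperm i j) W).
  - move=> l; have [k Wk] := W0 (tperm i j l); exists (tperm i j k).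
    by rewrite mxE tpermK.
  - by exists mu => // k; rewrite !mxE Wmu.
  by exists x; apply: represented_iso r; apply: perm_mx2_iso.
have [W01|] := col_dichotomy (W0 i0) (W0 i1); last exact: first_two.
have [W02|p02] := col_dichotomy (W0 i0) (W0 i2); last first.
  by apply: (perm i1 i2); rewrite tpermL tpermD.
have [W12|[mu mu0 p12]] := col_dichotomy (W0 i1) (W0 i2); last first.
  apply: (perm i0 i2); rewrite tpermL tpermD //.
  by exists mu^-1; rewrite ?invr_eq0 // => k; rewrite p12 mulKf.
apply: scattered_exists; do 2![apply: ord3_ind] => //= _ //; exact: indep_col_sym.
Qed.

Lemma algebra_represented (A : naAlgebra F) : \dim {:A} = 3%N ->
  evolution_algebra A -> non_degenerate A ->
  exists x, represented_by imag A x.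
Proof.
move=> dA [b [bB b0]] A0.
have sb : size b == 3%N.
  by apply/eqP; rewrite -dA; apply/esym/(size_basis (X := in_tuple b)).
pose B := Tuple sb; have BB : basis_of fullv B by [].
have B0 (i j : 'I_3) : i != j -> mul B`_i B`_j = 0.
  move=> ij; apply: b0; rewrite ?mem_nth ?(eqP sb) //.
  by rewrite nth_uniq ?(eqP sb) ?(free_uniq (basis_free bB)).
have AW := isomorphic_of_natural_basis BB B0; set W := (\matrix_(_, _) _) in AW.
have [j|x r] := @evo_represented W; last first.
  by exists x; apply: represented_iso (isomorphic_sym AW) r.
apply/existsP; apply: contraT; rewrite negb_exists => /forallP Wj.
have := natural_basis_sq_neq0 j BB B0 A0; rewrite (coord_basis BB (memvf (mul _ _))).
rewrite big1 ?eqxx // => k _; move: (Wj k); rewrite negbK mxE => /eqP->.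
by rewrite scale0r.
Qed.

Lemma trace111 (A : naAlgebra F) t0 t1 t2 :
  Delta_trace imag A [:: t0; t1; t2] ->
  all (fun t => block_dim t == 1%N) [:: t0; t1; t2] ->
  exists W : 'M[F]_3, [/\ isomorphic A (evo_alg W), indep_cols W &
    forall j : 'I_3, match nth (tO 0) [:: t0; t1; t2] j with
    | tO _ => W j j = 0 | tE _ => W j j != 0 | _ => True end].
Proof.
set t := [:: _; _; _] => -[_ _ [E [EA Et]]] td.
have ct j := component_type imag2 (Et j).
have nt (j : 'I_3) : block_dim (nth (tO 0) t j) = 1%N by apply/eqP/(all_nthP _ td).
have [|W [AW Wi Wd]] := decomposition_lines EA; first by move=> j; rewrite (ct j).1 nt.
exists W; split=> // j; have [W0 W1] := Wd j; have [_ cj] := ct j; move: cj (nt j) => /=.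
by case: (nth _ _ _) => //= m + m1; rewrite ?m1.
Qed.

(** Giving the family by its number lets the final case analysis on [x] discard the others by
    computation. *)
Lemma trace21 (A : naAlgebra F) t0 t1 : non_degenerate A ->
  Delta_trace imag A [:: t0; t1] -> block_dim t0 = 2%N -> block_dim t1 = 1%N ->
  exists x, represented_by imag A x /\
    match t0, t1 with
    | tO _, tO _ => planar_num x \in [:: 1; 2]%N
    | tO _, tE _ => planar_num x \in [:: 3; 4]%N
    | tE _, tO _ => planar_num x \in [:: 5; 6]%N
    | tE _, tE _ => planar_num x \in [:: 7]%N
    | tI _, tO _ => planar_num x \in [:: 8; 9; 10; 11]%N
    | tI _, tE _ => planar_num x \in [:: 12; 13; 14; 15]%N
    | _, _ => True
    end.
Proof.
move=> A0 [_ _ [/= E [EA Et]]] d2 d1.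
have [e0 c0] := component_type imag2 (Et 0).
have [e1 c1] := component_type imag2 (Et 1).
rewrite /= in e0 e1 c0 c1; rewrite d2 in e0; rewrite d1 in e1.
have [W [mu [AW mu0 Wmu Wi [cO cE cI cO1 cE1]]]] := decomposition_plane_line EA A0 e0 e1.
have [x [r xO xE xI]] := planar_classification imag2 two0 mu0 Wmu Wi.
exists x; split; first exact: represented_iso (isomorphic_sym AW) r.
case: t0 d2 c0 {e0 Et} => m0 /= m0E c0; case: t1 d1 c1 {e1} => m1 //= m1E c1;
  rewrite ?m0E in c0; rewrite ?m1E in c1.
- have [w0 w1] := cO c0; have w2 := cO1 c1.
  by have := xO w0 w1; rewrite w2 eqxx.
- have [w0 w1] := cO c0; have w2 := cE1 c1.
  by have := xO w0 w1; rewrite (negPf w2).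
- by have := xE (cE c0); rewrite (cO1 c1) eqxx.
- by have := xE (cE c0); rewrite (negPf (cE1 c1)).
- by have [N0 w0] := cI c0; have := xI N0 w0; rewrite (cO1 c1) eqxx.
by have [N0 w0] := cI c0; have := xI N0 w0; rewrite (negPf (cE1 c1)).
Qed.
End Classification.

(** * Isomorphisms between listed algebras *)

Section ListedIsomorphisms.
Variables (F : closedFieldType) (imag : F).
Hypotheses (imag2 : imag ^+ 2 = -1) (two0 : 2 != 0 :> F).
Implicit Types x y : listed F.

Lemma listed3_square_in_line x : listed_delta x = [:: 3]%N ->
  square_in_line (listed_alg imag x).
Proof. by move=> dx; apply: delta3_square_in_line; have [_] := admissible3 imag dx; rewrite dx. Qed.

Lemma listed_iso_delta x y : admissible imag x -> admissible imag y ->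
  isomorphic (listed_alg imag x) (listed_alg imag y) -> listed_delta x = listed_delta y.
Proof.
have no21 u v : admissible imag u -> listed_delta u = [:: 2; 1]%N ->
    listed_delta v = [:: 3]%N -> ~ isomorphic (listed_alg imag u) (listed_alg imag v).
  move=> [_ + _] du dv uv; rewrite du => /delta_square_in_line; apply.
  exact/(square_in_line_iso uv)/listed3_square_in_line.
(* Independence would pass to [v], whose first two columns are equal. *)
have no111 u v : admissible imag u -> listed_delta u = [:: 1; 1; 1]%N ->
    listed_delta v <> [:: 1; 1; 1]%N -> ~ isomorphic (listed_alg imag v) (listed_alg imag u).
  move=> ua du dv vu; have := indep_cols_iso (admissible_indep_cols ua du) vu.
  move=> /(_ i0 i1 isT 1 (-1))[|/eqP]; last by rewrite oner_eq0.
  by move=> k; rewrite listed_mx01 // mulN1r mul1r subrr.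
move=> xa ya xy; have yx := isomorphic_sym xy.
have [dx|dx|dx] := delta_of_listed x; have [dy|dy|dy] := delta_of_listed y;
  rewrite ?dx ?dy //; exfalso.
- by apply: (no111 x y) => //; rewrite dy.
- by apply: (no111 x y) => //; rewrite dy.
- by apply: (no111 y x) => //; rewrite dx.
- by apply: (no21 x y).
- by apply: (no111 y x) => //; rewrite dx.
- by apply: (no21 y x).
Qed.

(** Squares of squares vanish in I_3 but not in E_3. *)
Lemma E3_I3 : ~ isomorphic (listed_alg imag I3) (listed_alg imag E3).
Proof.
have E3E : listed_alg imag E3 = block_alg imag (tE 3).
  rewrite /listed_alg /=; congr evo_alg; apply/matrixP.
  by do 2![apply: ord3_ind]; rewrite !mxE.
have I3E : listed_alg imag I3 = block_alg imag (tI 3).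
  rewrite /listed_alg /=; congr evo_alg; apply/matrixP.
  by do 2![apply: ord3_ind]; rewrite !mxE /= ?mulr0 ?mulr1 ?addr0 ?add0r.
rewrite E3E I3E => IE.
have [//|x] := block_squares_iso IE (block_algP (tE 3) imag2).
have [//|_ ->] := block_algP (tI 3) imag2; by rewrite eqxx.
Qed.

Lemma planar_rel_listed x y : admissible imag x -> admissible imag y ->
  listed_delta x = [:: 2; 1]%N -> listed_delta y = [:: 2; 1]%N ->
  isomorphic (listed_alg imag x) (listed_alg imag y) ->
  planar_rel (listed_mx imag x) (listed_mx imag y).
Proof.
move=> xa ya dx dy xy; apply: planar_iso => //.
- by apply: listed_mx01; rewrite dx.
- by apply: listed_mx01; rewrite dy.
exact: admissible_indep_col.
Qed.

Lemma same_family_iso x y : admissible imag x -> admissible imag y ->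
  isomorphic (listed_alg imag x) (listed_alg imag y) -> same_family x y.
Proof.
move=> xa ya xy; have yx := isomorphic_sym xy.
have dxy := listed_iso_delta xa ya xy.
have [dx|dx|dx] := delta_of_listed x; have dy := dx; rewrite dxy in dy.
- have [f fi] := xy; have yi := admissible_indep_cols ya dy.
  have [s fs] := monomial_iso yi fi.
  have e : scattered_num x = scattered_num y.
    rewrite -!(scattered_code_listed imag) //; apply: (scattered_code_perm (s := s)) => k j.
    have f0 i : hom_mx f (s i) i != 0 by rewrite fs negbK.
    have := congr1 (fun a => a == 0) (monomial_iso_entries fi fs k j).
    by rewrite !mulf_eq0 !(negPf (f0 _)).
  by move: dx dy e; clear; case: x; case: y.
- have xyr := planar_rel_listed xa ya dx dy xy; have yxr := planar_rel_listed ya xa dy dx yx.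
  have num u : admissible imag u -> listed_delta u = [:: 2; 1]%N ->
      planar_code (listed_mx imag u) = planar_num u.
    move=> ua du; apply: planar_code_listed => //; first by case: ua.
    exact: admissible_indep_col.
  have e : planar_num x = planar_num y by rewrite -!num //; apply: planar_code_rel.
  by move: dx dy e; clear; case: x; case: y.
case: x dx xy yx {xa dxy} => //= _; case: y dy {ya} => //= _.
  by move=> _ /E3_I3.
by move=> /E3_I3.
Qed.

Lemma identified_iso x y : identified x y ->
  isomorphic (listed_alg imag x) (listed_alg imag y).
Proof.
have flip_sign x' y' : (forall k j, (if k == i1 then -1 else 1) * listed_mx imag x' k j =
    (if j == i1 then -1 else 1) ^+ 2 * listed_mx imag y' k j) ->
    isomorphic (listed_alg imag x') (listed_alg imag y').
  move=> xy; apply: (@isomorphic_monomial _ _ _ _ 1 (fun i => if i == i1 then -1 else 1)).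
    by apply: ord3_ind; rewrite /= ?oppr_eq0 oner_neq0.
  by move=> k j; rewrite xy !perm1.
have eq_case x' y' : x' = y' -> isomorphic (listed_alg imag x') (listed_alg imag y').
  by move=> ->; apply: isomorphic_refl.
case: x => [a b c|a|a b c e|a b c|a b|a b c e z|a b c e z w|||a||a b|a|a b c|a|s|||a b|a||a||];
  try exact: eq_case; case: y => //=.
- move=> a' b' [-> [->|->]]; first exact: isomorphic_refl.
  by apply: flip_sign; do 2![apply: ord3_ind]; rewrite !mxE /=; ring.
- move=> a' [->|->]; first exact: isomorphic_refl.
  (* The factor i on e_2 negates e_2^2, and the sign on e_1 restores its second coordinate. *)
  apply: (@isomorphic_monomial _ _ _ _ 1 (fun i => [:: 1; -1; imag]`_i)).
    by apply: ord3_ind; rewrite /= ?oppr_eq0 ?oner_neq0 ?imag_neq0.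
  by do 2![apply: ord3_ind]; rewrite !perm1 !mxE /= ?imag2; ring.
- move=> a' b' c' [-> -> [->|->]]; first exact: isomorphic_refl.
  by apply: flip_sign; do 2![apply: ord3_ind]; rewrite !mxE /=; ring.
Qed.

Lemma iso_identified x y : admissible imag x -> admissible imag y ->
  listed_delta x <> [:: 1; 1; 1]%N ->
  isomorphic (listed_alg imag x) (listed_alg imag y) -> identified x y.
Proof.
move=> xa ya dx1 xy; have xyf := same_family_iso xa ya xy.
have dxy := listed_iso_delta xa ya xy.
have [//|dx|dx] := delta_of_listed x; have dy := dx; rewrite dxy in dy.
  apply: (planar_identified imag2 two0) => //; first by case: ya.
    exact: admissible_indep_col.
  exact: planar_rel_listed.
by case: x dx xyf {xa dx1 xy dxy} => //= _; case: y {ya dy}.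
Qed.

Lemma listed_mx_diag x : listed_delta x = [:: 1; 1; 1]%N ->
  forall k, listed_mx imag x k k = 0 \/ listed_mx imag x k k = 1.
Proof. by move=> dx k; case: x dx => //= *; move: k; apply: ord3_ind; rewrite mxE /=; auto. Qed.

(** For [A37] the diagonal entries are 1 in [x] and 0 or 1 in [y], and c = c^2 d with c != 0 and d
    in {0, 1} gives c = 1. Elsewhere scalars do occur: seventh roots of unity act on [A31 0 0 0]. *)
Lemma scattered_iso x y (f : 'Hom(listed_alg imag x, listed_alg imag y)) :
  admissible imag y -> listed_delta y = [:: 1; 1; 1]%N -> is_algebra_iso f ->
  permutes_basis_up_to_scalars f /\
  (if x is A37 _ _ _ _ _ _ then permutes_basis f else True).
Proof.
move=> ya dy fi; have yi := admissible_indep_cols ya dy.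
have [s fs] := monomial_iso yi fi.
have f0 i : hom_mx f (s i) i != 0 by rewrite fs negbK.
have fE j : f (evo_basis _ j) = hom_mx f (s j) j *: evo_basis _ (s j).
  apply/colP=> k; rewrite hom_mxE -colE !mxE eqxx andbT.
  have [->|ks] := eqVneq k (s j); first by rewrite mulr1.
  by have := fs k j; rewrite ks mulr0 mxE => /eqP.
split; first by exists s, (fun j => hom_mx f (s j) j) => j; split.
case: x f fi fs f0 fE => // a b c e z w f fi fs f0 fE; exists s => j; rewrite fE.
suff -> : hom_mx f (s j) j = 1 by rewrite scale1r.
have := monomial_iso_entries fi fs j j.
have -> : listed_mx imag (A37 a b c e z w) j j = 1.
  by move: j; apply: ord3_ind; rewrite mxE.
have [->|->] := listed_mx_diag dy (s j); rewrite !mulr1.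
  by rewrite mulr0 => /eqP; rewrite (negPf (f0 j)).
by rewrite expr2 -{1}[hom_mx _ _ _]mulr1 => /(mulfI (f0 j)).
Qed.
End ListedIsomorphisms.

Theorem theorem30 (F : closedFieldType) (charF0 : [pchar F] =i pred0)
    (imag : F) (imag2 : imag ^+ 2 = -1) :
  (* every algebra is isomorphic to a listed one *)
  (forall A : naAlgebra F,
    \dim {: A} = 3%N -> evolution_algebra A -> non_degenerate A ->
    let rep := represented_by imag A in
    [/\ exists x, rep x,
        delta_index A [:: 1; 1; 1]%N ->
        [/\ Delta_trace imag A [:: tO 1; tO 1; tO 1] ->
              (exists a b c, rep (A31 a b c)) \/ (exists a, rep (A32 a)),
            Delta_trace imag A [:: tO 1; tO 1; tE 1] ->
              [\/ exists a b c e, rep (A33 a b c e),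
                  exists a b c, rep (A34 a b c) |
                  exists a b, rep (A35 a b)],
            Delta_trace imag A [:: tO 1; tE 1; tE 1] ->
              exists a b c e z, rep (A36 a b c e z) &
            Delta_trace imag A [:: tE 1; tE 1; tE 1] ->
              exists a b c e z x, rep (A37 a b c e z x)],
        delta_index A [:: 2; 1]%N ->
        (Delta_trace imag A [:: tO 2; tO 1] -> rep B31 \/ rep B32) /\
        (Delta_trace imag A [:: tO 2; tE 1] ->
           (exists a, rep (B33 a)) \/ rep B34) /\
        (Delta_trace imag A [:: tE 2; tO 1] ->
           (exists a b, rep (B35 a b)) \/ (exists a, rep (B36 a))) /\
        (Delta_trace imag A [:: tE 2; tE 1] ->
           exists a b c, rep (B37 a b c)) /\
        (Delta_trace imag A [:: tI 2; tO 1] ->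
           [\/ exists a, rep (B38 a),
               exists s, rep (B39 s),
               rep B310 |
               rep B311]) /\
        (Delta_trace imag A [:: tI 2; tE 1] ->
           [\/ exists a b, rep (B312 a b),
               exists a, rep (B313 a),
               rep B314 |
               exists a, rep (B315 a)]) &
        delta_index A [:: 3]%N -> rep E3 \/ rep I3])
  /\
  (* isomorphic listed algebras belong to the same family *)
  (forall x y : listed F, admissible imag x -> admissible imag y ->
     isomorphic (listed_alg imag x) (listed_alg imag y) -> same_family x y)
  /\
  (* the isomorphisms in case (I) *)
  (forall x y : listed F, admissible imag x -> admissible imag y ->
     listed_delta x = [:: 1; 1; 1]%N -> listed_delta y = [:: 1; 1; 1]%N ->
     forall f : 'Hom(listed_alg imag x, listed_alg imag y), is_algebra_iso f ->
       permutes_basis_up_to_scalars f /\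
       (if x is A37 _ _ _ _ _ _ then permutes_basis f else True))
  /\
  (* the isomorphisms in cases (II) and (III) *)
  (forall x y : listed F, admissible imag x -> admissible imag y ->
     listed_delta x <> [:: 1; 1; 1]%N -> listed_delta y <> [:: 1; 1; 1]%N ->
     (isomorphic (listed_alg imag x) (listed_alg imag y) <-> identified x y)).
Proof.
have two0 : 2 != 0 :> F by have /pcharf0P -> := charF0.
split; last first.
  split; first exact: same_family_iso.
  split; first by move=> x y _ ya _ dy f; apply: scattered_iso.
  by move=> x y xa ya dx _; split; [apply: iso_identified | apply: identified_iso].
move=> A dA evoA A0 rep.
have [x0 [x0a Ax0]] := algebra_represented imag2 two0 dA evoA A0.
split; first by exists x0.
- move=> _; split=> /(trace111 imag2)/(_ isT)[W [AW Wi Wd]];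
    have := Wd i0; have := Wd i1; have := Wd i2; move=> /= d2 d1 d0;
    have lift x := @represented_iso _ imag _ _ x (isomorphic_sym AW).
  + have [[a [b [c /lift r]]]|[a /lift r]] := represented_OOO imag Wi d0 d1 d2.
      by left; exists a, b, c.
    by right; exists a.
  + have [[a [b [c [e /lift r]]]]|[a [b [c /lift r]]]|[a [b /lift r]]] :=
      represented_OOE imag Wi d0 d1 d2.
    * by apply: Or31; exists a, b, c, e.
    * by apply: Or32; exists a, b, c.
    by apply: Or33; exists a, b.
  + have [a [b [c [e [z /lift r]]]]] := represented_OEE imag Wi d0 d1 d2.
    by exists a, b, c, e, z.
  have [a [b [c [e [z [x /lift r]]]]]] := represented_A37 imag Wi d0 d1 d2.
  by exists a, b, c, e, z, x.
(* Membership of [planar_num x] in the list discards every family outside the bullet. *)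
- move=> _; do !split; move=> /(trace21 imag2 two0 A0)/(_ erefl erefl)[];
    case=> [a b c|a|a b c e|a b c|a b|a b c e z|a b c e z w|||a||a b|a|a b c|a|s|||a b|a||a||];
    case=> // r _.
  all: try (by left); try (by right).
  all: try (by left; exists a); try (by left; exists a, b); try (by right; exists a).
  all: try (by exists a, b, c).
  + by apply: Or41; exists a.
  + by apply: Or42; exists s.
  + exact: Or43.
  + exact: Or44.
  + by apply: Or41; exists a, b.
  + by apply: Or42; exists a.
  + exact: Or43.
  by apply: Or44; exists a.
move=> /delta3_square_in_line A3.
have x03 := square_in_line_iso (isomorphic_sym Ax0) A3.
have [_ dx _] := x0a.
have x0_3 : listed_delta x0 = [:: 3]%N.
  have [e|e|//] := delta_of_listed x0; rewrite e in dx;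
  by case: (delta_square_in_line dx x03).
by case: x0 x0_3 x0a Ax0 {dx x03} => //= _ xa Ax; [left | right].
Qed.
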